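(* Let $n\ge 3$, $R>0$ and $k\ge 0$. For any polynomial $f\in\mathcal{P}_k$, the function $$x\mapsto\int_{|y|=R}\Gamma(x-y)f(y)\,d\sigma_y,\qquad x\in\mathbb{R}^n,\ |x|<R,$$ belongs to $\mathcal{P}_k$.
   Context: $\Gamma(x)=c_n|x|^{2-n}$, $c_n=\frac{1}{n(2-n)\omega_n}$ with $\omega_n$ the volume of the unit ball of $\mathbb{R}^n$, is the fundamental solution of the Laplacian in $\mathbb{R}^n$. $\mathcal{P}_k$ is the space of polynomials on $\mathbb{R}^n$ of degree at most $k$, restricted to $\{x\in\mathbb{R}^n:|x|<R\}$ (the values of $f$ on $|y|=R$ are those of the polynomial). $d\sigma_y$ is the surface area element of $\{y\in\mathbb{R}^n:|y|=R\}$. *)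

(* Defs.v *)
From HB Require Import structures.
From mathcomp Require Import all_boot all_order all_algebra.
(* The notations of mpoly clash with those of all_analysis. *)
From mathcomp Require mpoly.
Import -(notations) mpoly.
From mathcomp Require Import all_classical all_reals all_analysis.

Set Implicit Arguments.
Unset Strict Implicit.
Unset Printing Implicit Defensive.

Import Order.TTheory GRing.Theory Num.Theory.
Import numFieldNormedType.Exports.

Local Open Scope classical_set_scope.
Local Open Scope ring_scope.

Section lebesgue_tuple.
Context {R : realType}.
Local Notation RT := (measurableTypeR R).

Section cons_measure.
Variables (n : nat) (mu : {sigma_finite_measure set (n.-tuple RT) -> \bar R}).

Definition tuple_cons (p : RT * n.-tuple RT) : n.+1.-tuple RT :=
  [tuple of p.1 :: p.2].

Lemma measurable_tuple_cons : measurable_fun setT tuple_cons.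
Proof. exact: (measurable_cons measurable_fst measurable_snd). Qed.

(* Lebesgue measure times mu, carried to tuples along R x R^n = R^(n+1). *)
Definition cons_measure : set (n.+1.-tuple RT) -> \bar R :=
  pushforward (@lebesgue_measure R \x mu)%E tuple_cons.

Let measurable_preimage_cons (A : set (n.+1.-tuple RT)) :
  measurable A -> measurable (tuple_cons @^-1` A).
Proof.
by move=> mA; rewrite -[X in measurable X]setTI; exact: measurable_tuple_cons.
Qed.

Let cons_measure0 : cons_measure set0 = 0%E.
Proof. by rewrite /cons_measure /pushforward preimage_set0 measure0. Qed.

Let cons_measure_ge0 A : (0 <= cons_measure A)%E.
Proof. by rewrite /cons_measure /pushforward measure_ge0. Qed.

Let cons_measure_sigma_additive : semi_sigma_additive cons_measure.
Proof.
move=> F mF tF mUF; rewrite /cons_measure /pushforward preimage_bigcup.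
apply: measure_semi_sigma_additive.
- by move=> i; exact: measurable_preimage_cons.
- apply/trivIsetP => /= i j _ _ ij; rewrite -preimage_setI.
  by move/trivIsetP : tF => /(_ _ _ _ _ ij) ->//; rewrite preimage_set0.
- by rewrite -preimage_bigcup; exact: measurable_preimage_cons.
Qed.

HB.instance Definition _ := isMeasure.Build _ _ _ cons_measure
  cons_measure0 cons_measure_ge0 cons_measure_sigma_additive.

Let cons_measure_sigma_finite : sigma_finite setT cons_measure.
Proof.
have /sigma_finiteP[F [TF ndF Foo]] := sigma_finiteT (@lebesgue_measure R).
have /sigma_finiteP[G [TG ndG Goo]] := sigma_finiteT mu.
pose hd (t : n.+1.-tuple RT) : RT := tnth t ord0.
pose tl (t : n.+1.-tuple RT) : n.-tuple RT := [tuple of behead t].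
exists (fun i => hd @^-1` F i `&` tl @^-1` G i).
  rewrite predeqE => t; split=> // _.
  have [i _ Fi] : (\bigcup_i F i) (hd t) by rewrite -TF.
  have [j _ Gj] : (\bigcup_i G i) (tl t) by rewrite -TG.
  exists (maxn i j) => //; split.
  - by move: Fi; rewrite /preimage/=; exact/subsetPset/ndF/leq_maxl.
  - by move: Gj; rewrite /preimage/=; exact/subsetPset/ndG/leq_maxr.
move=> i; have [mF Fi] := Foo i; have [mG Gi] := Goo i; split.
  apply: measurableI; rewrite -[X in measurable X]setTI.
  - exact: measurable_tnth.
  - exact: measurable_behead.
rewrite /cons_measure /pushforward.
rewrite (_ : _ @^-1` _ = F i `*` G i).
  by rewrite product_measure1E// lte_mul_pinfty// ge0_fin_numE.
rewrite predeqE => -[x t] /=.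
by rewrite /hd /tl (_ : [tuple of _] = t)//; exact: val_inj.
Qed.

HB.instance Definition _ := Measure_isSigmaFinite.Build _ _ _ cons_measure
  cons_measure_sigma_finite.

End cons_measure.

Fixpoint lebesgue_tuple (n : nat) :
    {sigma_finite_measure set (n.-tuple RT) -> \bar R} :=
  match n with
  | 0 => dirac ([tuple] : 0.-tuple RT)
  | m.+1 => cons_measure (lebesgue_tuple m)
  end.

End lebesgue_tuple.

Section sphere.
Context {R : realType}.
Local Notation RT := (measurableTypeR R).

(* The library norm `|x| on 'rV[R]_n is the sup norm. *)
Definition eucl_norm (n : nat) (x : 'rV[R]_n) : R :=
  Num.sqrt (\sum_(i < n) x 0 i ^+ 2).

Definition eucl_ball (n : nat) (r : R) : set 'rV[R]_n :=
  [set x | eucl_norm x < r].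

(* Row vectors carry the calculus, tuples carry the Lebesgue measure. *)
Definition row_of_tuple (n : nat) (t : n.-tuple RT) : 'rV[R]_n :=
  \row_(i < n) tnth t i.

Definition unit_ball_volume (n : nat) : R :=
  fine (lebesgue_tuple n (@row_of_tuple n @^-1` eucl_ball 1)).

Definition fundamental_solution (n : nat) (x : 'rV[R]_n) : R :=
  (n%:R * (2 - n%:R) * unit_ball_volume n)^-1 * eucl_norm x ^ (2 - n%:Z).

(* The point (u, z) of R^(n-1) x R = R^n, for n > 0: the last index n - 1 is
   out of range for u, so that coordinate is the default value z. *)
Definition graph_point (n : nat) (u : n.-1.-tuple RT) (z : R) : 'rV[R]_n :=
  \row_(i < n) nth z u i.

(* sqrt (1 + |grad h|^2) *)
Definition graph_area_element (m : nat) (h : 'rV[R]_m -> R)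
    (u : 'rV[R]_m) : R :=
  Num.sqrt (1 + \sum_(i < m) ('D_(delta_mx 0 i) h u) ^+ 2).

(* Surface integral of g over the graph of h above D. *)
Definition graph_integral (n : nat) (D : set 'rV[R]_n.-1)
    (h : 'rV[R]_n.-1 -> R) (g : 'rV[R]_n -> R) : R :=
  \int[lebesgue_tuple n.-1]_(u in @row_of_tuple n.-1 @^-1` D)
    (g (graph_point u (h (row_of_tuple u))) *
     graph_area_element h (row_of_tuple u)).

Definition hemisphere (m : nat) (r : R) (u : 'rV[R]_m) : R :=
  Num.sqrt (r ^+ 2 - eucl_norm u ^+ 2).

(* Surface integral of g over {y in R^n : |y| = r}, as the sum over the open
   upper and lower hemispheres; the equator they omit is negligible. *)
Definition sphere_integral (n : nat) (r : R) (g : 'rV[R]_n -> R) : R :=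
  graph_integral (eucl_ball r) (hemisphere r) g +
  graph_integral (eucl_ball r) (fun u => - hemisphere r u) g.

(* The value at x of a polynomial in n variables. *)
Definition poly_fun (n : nat) (p : mpoly n R) (x : 'rV[R]_n) : R :=
  meval (x 0) p.

(* msize is the total degree plus one, and 0 for the zero polynomial. *)
Definition degree_at_most (n k : nat) (p : mpoly n R) : Prop :=
  (msize p <= k.+1)%N.

(* g restricted to the ball |x| < r is a polynomial of degree at most k. *)
Definition poly_on_ball (n k : nat) (r : R) (g : 'rV[R]_n -> R) : Prop :=
  exists p : mpoly n R,
    degree_at_most k p /\ forall x, eucl_norm x < r -> g x = poly_fun p x.

End sphere.

(* Main.v *)
Require Import Defs.
From mathcomp Require Import all_boot all_order all_algebra.
From mathcomp Require mpoly.
Import -(notations) mpoly.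
From mathcomp Require Import all_classical all_reals all_analysis.
From mathcomp Require Import measurable_realfun.
From mathcomp Require Import ring lra zify.

Import Order.TTheory GRing.Theory Num.Theory.
Import numFieldNormedType.Exports.
Local Open Scope classical_set_scope.
Local Open Scope ring_scope.

(** The Newtonian kernel has, for |x| < r = |y| and d = n - 2, the expansion

      r ^ d / |x - y| ^ d = sum over k of kappa_k * Z_k(x, y) / r ^ (2 k)

    obtained from the generating function (1 - 2 b t + a t ^ 2) ^ (- d / 2) of
    the Gegenbauer polynomials, where Z_k(x, y) is a polynomial in (x, y) that
    is homogeneous of degree k in each of x and y, and harmonic in y.  On the
    sphere a harmonic homogeneous polynomial of degree k is orthogonal to every
    polynomial of degree < k.  Hence, when f has degree at most k, integrating
    the expansion against f kills all the terms of index > k, and each of the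
    remaining ones contributes a polynomial in x of degree at most k.

    Three facts carry the argument.

    - Orthogonality ([orthogonal_harmonic]).  It holds for any linear
      functional L on polynomials for which
      r ^ 2 * L (d_i p) = (deg p + n - 1) * L (X_i * p) for homogeneous p: this
      gives r ^ 2 * L (laplacian p) = deg p * (deg p + n - 2) * L p, and applied
      to p = h * f with h harmonic it allows an induction on the degree of f.

    - Convergence ([kernel_poly_error]).  Both the bound |Z_k| <= (|x| r) ^ k and
      the estimate of the remainder come from the three-term recurrence of the
      Z_k: the former by an energy that decreases along the recurrence, the
      latter because a partial sum of the generating series solves the
      differential equation of the generating function up to two monomials.
      The error is uniform in y, so it survives integration over the sphere.

    - Integration over the sphere ([sphere_divergence]).  The integral of every
      monomial over a hemisphere graph is computed: by Fubini and the
      substitution t = r * sin s it is a product of Wallis integrals, and the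
      required property of the functional reduces to the recurrences
      satisfied by these integrals. *)

Set Implicit Arguments.
Unset Strict Implicit.
Unset Printing Implicit Defensive.

(** * Harmonic polynomials and orthogonality *)

Section harmonic.
Context {R : realType} {n : nat}.
Implicit Types (p q f h : mpoly n R) (i : 'I_n) (j d m : nat).

Local Notation var i := (mpolyX R (mnm1 i)).
Local Notation homog d := (ishomog1 d (@mdeg n)).

Lemma homog_var i : var i \is homog 1.
Proof. by rewrite dhomogX; apply/eqP; exact: mdeg1. Qed.

Lemma homogM d1 d2 p q :
  p \is homog d1 -> q \is homog d2 -> p * q \is homog (d1 + d2).
Proof. exact: dhomogM. Qed.

Lemma mnm_subK1 (a : multinom n) i : a i != 0%N ->
  mnm_add (mnm_sub a (mnm1 i)) (mnm1 i) = a.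
Proof.
move=> ai; rewrite submK//; apply/mnm_lepP => k; rewrite mnm1E.
by case: eqP => // <-; rewrite lt0n.
Qed.

Lemma mderiv_homog0 i p : p \is homog 0 -> mderiv i p = 0.
Proof.
move=> /dhomogP hp; rewrite (_ : p = mpolyC n (mcoeff mnm0 p)) ?mderivC//.
by apply: msize1_polyC; rewrite msizeE; apply/bigmax_leqP_seq => m /hp ->.
Qed.

Lemma mderiv_homog i d p : p \is homog d -> mderiv i p \is homog d.-1.
Proof.
move=> /dhomogP hp; rewrite [p]mpolyE linear_sum /= big_seq.
apply: rpred_sum => m /hp /= dm; rewrite linearZ /= mderivX rpredZ//.
have [->|mi0] := eqVneq (m i) 0%N; first by rewrite scale0r rpred0.
apply: rpredZ; rewrite dhomogX -dm.
by rewrite -[X in _ == (mdeg X).-1](mnm_subK1 mi0) mdegD mdeg1 addn1.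
Qed.

Lemma euler_homog d p : p \is homog d ->
  \sum_i var i * mderiv i p = d%:R *: p.
Proof.
move=> /dhomogP hp; rewrite {2}[p]mpolyE scaler_sumr.
under eq_bigr => i _ do rewrite {1}[p]mpolyE linear_sum /= mulr_sumr.
rewrite exchange_big /= big_seq [RHS]big_seq; apply: eq_bigr => m /hp /= dm.
rewrite -dm mdegE natr_sum scaler_suml; apply: eq_bigr => i _.
rewrite linearZ /= mderivX -!scalerAr scalerA [in RHS]scalerA.
have [->|mi0] := eqVneq (m i) 0%N; first by rewrite mulr0 mul0r !scale0r.
rewrite [in RHS]mulrC -mpolyXD; congr (_ *: mpolyX _ _).
by rewrite addmC mnm_subK1.
Qed.

Definition laplacian p := \sum_i mderiv i (mderiv i p).

Lemma laplacianM p q : laplacian (p * q) =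
  laplacian p * q + (\sum_i mderiv i p * mderiv i q) *+ 2 + p * laplacian q.
Proof.
rewrite /laplacian mulr_suml mulr_sumr -sumrMnl -!big_split /=.
by apply: eq_bigr => i _; rewrite !(mderivM, mderivD); ring.
Qed.

Lemma laplacianB p q : laplacian (p - q) = laplacian p - laplacian q.
Proof.
by rewrite /laplacian -sumrB; apply: eq_bigr => i _; rewrite !mderivB.
Qed.

Lemma laplacianZ (c : R) p : laplacian (c *: p) = c *: laplacian p.
Proof.
by rewrite /laplacian scaler_sumr; apply: eq_bigr => i _; rewrite !mderivZ.
Qed.

Lemma laplacian_mderiv i p : laplacian (mderiv i p) = mderiv i (laplacian p).
Proof.
rewrite /laplacian linear_sum /=; apply: eq_bigr => j _.
by rewrite (mderiv_comm i j) (mderiv_comm i j).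
Qed.

Section orthogonality.
Variables (r2 : R) (L : mpoly n R -> R).
Hypothesis n2 : (2 <= n)%N.
Hypothesis L_linear : forall (c : R) p q, L (c *: p + q) = c * L p + L q.
Hypothesis L_div : forall i d p, p \is homog d ->
  r2 * L (mderiv i p) = (d + n.-1)%:R * L (var i * p).

Lemma functional0 : L 0 = 0.
Proof.
have := L_linear 1 0 0; rewrite scale1r addr0 mul1r => /eqP.
by rewrite -subr_eq0 opprD addNKr oppr_eq0 => /eqP.
Qed.

Lemma functionalD p q : L (p + q) = L p + L q.
Proof. by have := L_linear 1 p q; rewrite scale1r mul1r. Qed.

Lemma functionalZ (c : R) p : L (c *: p) = c * L p.
Proof. by have := L_linear c p 0; rewrite functional0 !addr0. Qed.

Lemma functional_sum (I : Type) (s : seq I) (P : pred I) (F : I -> mpoly n R) :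
  L (\sum_(x <- s | P x) F x) = \sum_(x <- s | P x) L (F x).
Proof. exact: (big_morph L functionalD functional0). Qed.

(** Applying the divergence identity to the polynomials [mderiv i p] and summing
    over i makes Euler's identity appear on the right. *)
Lemma functional_laplacian d p : p \is homog d ->
  r2 * L (laplacian p) = (d * (d + n - 2))%:R * L p.
Proof.
case: d => [|d] hp.
  rewrite mul0n mul0r /laplacian big1 ?functional0 ?mulr0// => i _.
  by rewrite (mderiv_homog0 i hp) mderiv0.
rewrite /laplacian functional_sum mulr_sumr.
under eq_bigr => i _ do rewrite (L_div i (mderiv_homog i hp)).
rewrite -mulr_sumr -functional_sum (euler_homog hp) functionalZ mulrA.
rewrite -natrM; congr (_%:R * _).
by rewrite /=; nia.
Qed.

(** Since h is harmonic, the laplacian of h * f consists of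
    2 * grad h . grad f, a sum of products of a harmonic polynomial of degree
    m - 1 and a polynomial of degree j - 1, and of h * laplacian f, where the
    second factor has degree j - 2.  By induction L vanishes on both, hence on
    h * f by [functional_laplacian]. *)
Lemma orthogonal_harmonic j m h f : (j < m)%N ->
  h \is homog m -> laplacian h = 0 -> f \is homog j -> L (h * f) = 0.
Proof.
elim/ltn_ind: j m h f => j IH m h f jm hh lh hf.
have /eqP : r2 * L (laplacian (h * f)) = 0.
  rewrite laplacianM lh mul0r add0r functionalD mulr2n functionalD.
  have -> : L (\sum_i mderiv i h * mderiv i f) = 0.
    rewrite functional_sum big1// => i _.
    case: j IH jm hf => [|j] IH jm hf.
      by rewrite (mderiv_homog0 i hf) mulr0 functional0.
    apply: (IH j _ m.-1) => //; first by lia.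
    - exact: mderiv_homog.
    - by rewrite laplacian_mderiv lh mderiv0.
    - exact: (mderiv_homog i hf).
  rewrite /laplacian mulr_sumr functional_sum big1 ?addr0 ?mulr0// => i _.
  case: j IH jm hf => [|[|j]] IH jm hf.
  - by rewrite (mderiv_homog0 i hf) mderiv0 mulr0 functional0.
  - by rewrite (mderiv_homog0 i (mderiv_homog i hf)) mulr0 functional0.
  - apply: (IH j _ m) => //; first by lia.
    exact: (mderiv_homog i (mderiv_homog i hf)).
rewrite (functional_laplacian (homogM hh hf)) mulf_eq0 => /orP[|/eqP//].
by rewrite pnatr_eq0 muln_eq0 => /orP[/eqP|/eqP]; lia.
Qed.

End orthogonality.

Section zonal.
Variable x : 'rV[R]_n.

Definition dot_poly : mpoly n R := \sum_i x 0 i *: var i.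
Definition normsq_poly : mpoly n R := \sum_i var i ^+ 2.
Let N : R := \sum_i x 0 i ^+ 2.

(** The solid zonal harmonic (|x| |y|) ^ m * C_m (x . y / (|x| |y|)) as a
    polynomial in y, where C_m is the Gegenbauer polynomial of parameter
    (n - 2) / 2 normalized by C_m (1) = 1.  The recurrence is the three-term
    recurrence of the C_m. *)
Fixpoint zonal (m : nat) : mpoly n R :=
  if m is m1.+1 then
    if m1 is m2.+1 then
      (m1 + (n - 2))%:R^-1 *:
        ((m1.*2 + (n - 2))%:R *: (dot_poly * zonal m1)
         - (m1%:R * N) *: (normsq_poly * zonal m2))
    else dot_poly
  else 1.

Lemma zonal_rec m : (m.+1 + (n - 2))%:R *: zonal m.+2 =
  (m.+1.*2 + (n - 2))%:R *: (dot_poly * zonal m.+1)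
  - (m.+1%:R * N) *: (normsq_poly * zonal m).
Proof. by rewrite [zonal m.+2]/= scalerA divff ?scale1r// pnatr_eq0. Qed.

Lemma homog_dot_poly : dot_poly \is homog 1.
Proof. by apply: rpred_sum => i _; rewrite rpredZ// homog_var. Qed.

Lemma homog_normsq_poly : normsq_poly \is homog 2.
Proof. by apply: rpred_sum => i _; rewrite expr2 (@homogM 1 1) ?homog_var. Qed.

Lemma homog_zonal m : zonal m \is homog m.
Proof.
suff: (zonal m \is homog m) && (zonal m.+1 \is homog m.+1) by case/andP.
elim: m => [|m /andP[h0 h1]]; first by rewrite dhomog1 homog_dot_poly.
rewrite h1 [zonal m.+2]/= rpredZ// rpredB// rpredZ//.
- exact: (homogM homog_dot_poly h1).
- exact: (homogM homog_normsq_poly h0).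
Qed.

Definition dirderiv p : mpoly n R := \sum_i x 0 i *: mderiv i p.

Lemma dirderivM p q : dirderiv (p * q) = dirderiv p * q + p * dirderiv q.
Proof.
rewrite /dirderiv mulr_suml mulr_sumr -big_split /=; apply: eq_bigr => i _.
by rewrite mderivM scalerDr scalerAl scalerAr.
Qed.

Lemma dirderivB p q : dirderiv (p - q) = dirderiv p - dirderiv q.
Proof.
by rewrite /dirderiv -sumrB; apply: eq_bigr => i _; rewrite mderivB scalerBr.
Qed.

Lemma dirderivZ (c : R) p : dirderiv (c *: p) = c *: dirderiv p.
Proof.
rewrite /dirderiv scaler_sumr; apply: eq_bigr => i _.
by rewrite mderivZ !scalerA mulrC.
Qed.

Lemma mderiv_var i k : mderiv i (var k) = (i == k)%:R.
Proof.
rewrite mderivX mnm1E eq_sym; case: eqP => [->|_]; last by rewrite scale0r.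
rewrite scale1r (_ : mnm_sub _ _ = mnm0) ?mpolyX0//.
by apply/mnmP => a; rewrite mnmBE mnm0E subnn.
Qed.

Lemma mderiv_dot_poly i : mderiv i dot_poly = (x 0 i)%:A.
Proof.
rewrite /dot_poly linear_sum /= (bigD1 i)//= mderivZ mderiv_var eqxx big1 ?addr0//.
by move=> k ki; rewrite mderivZ mderiv_var eq_sym (negbTE ki) scaler0.
Qed.

Lemma mderiv_normsq_poly i : mderiv i normsq_poly = 2 *: var i.
Proof.
rewrite /normsq_poly linear_sum /= (bigD1 i)//= expr2 mderivM mderiv_var eqxx.
rewrite big1 ?addr0; first by rewrite mul1r mulr1 scaler_nat mulr2n.
move=> k ki; rewrite expr2 mderivM mderiv_var eq_sym (negbTE ki).
by rewrite mul0r mulr0 addr0.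
Qed.

Lemma dirderiv_dot_poly : dirderiv dot_poly = N%:A.
Proof.
rewrite /dirderiv /N scaler_suml; apply: eq_bigr => i _.
by rewrite mderiv_dot_poly scalerA expr2.
Qed.

Lemma dirderiv_normsq_poly : dirderiv normsq_poly = 2 *: dot_poly.
Proof.
rewrite /dirderiv /dot_poly scaler_sumr; apply: eq_bigr => i _.
by rewrite mderiv_normsq_poly !scalerA mulrC.
Qed.

Hypothesis n3 : (3 <= n)%N.

(** This Appell property, an induction on the recurrence, is what makes
    [zonal m] harmonic: it evaluates the cross term of the laplacian of
    [dot_poly * zonal m]. *)
Lemma dirderiv_zonal m :
  dirderiv (zonal m.+1) = (m.+1%:R * N) *: zonal m.
Proof.
suff: dirderiv (zonal m.+1) = (m.+1%:R * N) *: zonal m /\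
      dirderiv (zonal m.+2) = (m.+2%:R * N) *: zonal m.+1 by case.
have dg0 k : (k.+1 + (n - 2))%:R != 0 :> R by rewrite pnatr_eq0.
have D2 k : dirderiv (zonal k.+1) = (k.+1%:R * N) *: zonal k ->
   normsq_poly * dirderiv (zonal k) =
     (k%:R * N) *: (normsq_poly * zonal k.-1) ->
   dirderiv (zonal k.+2) = (k.+2%:R * N) *: zonal k.+1.
  move=> h1 h0; apply: (scalerI (dg0 k)).
  rewrite -dirderivZ zonal_rec dirderivB !dirderivZ !dirderivM.
  rewrite dirderiv_dot_poly dirderiv_normsq_poly h1 h0.
  have hk : (k + (n - 2))%:R *: zonal k.+1 =
      (k.*2 + (n - 2))%:R *: (dot_poly * zonal k)
        - (k%:R * N) *: (normsq_poly * zonal k.-1).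
    case: k {h1 h0} => [|k]; last exact: zonal_rec.
    by rewrite mul0r scale0r subr0 add0n mulr1.
  (* hk eliminates zonal k.-1; what remains holds in any commutative ring *)
  have -> : (k%:R * N) *: (normsq_poly * zonal k.-1) =
     (k.*2 + (n - 2))%:R *: (dot_poly * zonal k) -
     (k + (n - 2))%:R *: zonal k.+1 by rewrite hk; ring.
  rewrite scalerA -!mul_mpolyC -!mul2n.
  move: (zonal k.+1) (zonal k) (n - 2)%N => u v e.
  ring.
elim: m => [|m [h0 h1]].
  split; first by rewrite dirderiv_dot_poly mul1r.
  apply: D2; first by rewrite dirderiv_dot_poly mul1r.
  rewrite mul0r scale0r /dirderiv big1 ?mulr0// => i _.
  by rewrite /= -mpolyC1 mderivC scaler0.
split=> //; apply: D2 => //; rewrite h0 -scalerAr//.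
Qed.

Lemma laplacian_zonal m : laplacian (zonal m) = 0.
Proof.
suff: laplacian (zonal m) = 0 /\ laplacian (zonal m.+1) = 0 by case.
have lap1 : laplacian 1 = 0.
  by rewrite /laplacian big1// => i _; rewrite -mpolyC1 mderivC mderiv0.
have ldot : laplacian dot_poly = 0.
  rewrite /laplacian big1// => i _.
  by rewrite mderiv_dot_poly -mpolyC1 -mul_mpolyC -mpolyCM mderivC.
have lsq : laplacian normsq_poly = (2 * n%:R)%:A.
  rewrite /laplacian (eq_bigr (fun=> 2%:A)).
    by rewrite sumr_const card_ord scalerMnl mulr_natr.
  by move=> i _; rewrite mderiv_normsq_poly mderivZ mderiv_var eqxx.
elim: m => [|m [h0 h1]]; first by split.
split=> //.
have dg0 : (m.+1 + (n - 2))%:R != 0 :> R by rewrite pnatr_eq0.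
apply: (scalerI dg0); rewrite scaler0 -laplacianZ zonal_rec laplacianB.
rewrite !laplacianZ !laplacianM ldot lsq h0 h1 !mulr0 !mul0r !addr0 add0r.
have -> : \sum_i mderiv i dot_poly * mderiv i (zonal m.+1) = dirderiv (zonal m.+1).
  by apply: eq_bigr => i _; rewrite mderiv_dot_poly -scalerAl mul1r.
have -> : \sum_i mderiv i normsq_poly * mderiv i (zonal m) = (2 * m%:R) *: zonal m.
  under eq_bigr => i _ do rewrite mderiv_normsq_poly -scalerAl.
  by rewrite -scaler_sumr (euler_homog (homog_zonal m)) scalerA.
rewrite dirderiv_zonal -!scalerAl mul1r -!mul_mpolyC -!mulrnAr.
have -> : n%:R = (n - 2)%:R + 2 :> R by rewrite -natrD subnK// ltnW.
rewrite -mul2n.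
move: (zonal m) (n - 2)%N => u e; ring.
Qed.

End zonal.

Section moments.
Variables (r2 : R) (L : mpoly n R -> R).
Hypothesis n3 : (3 <= n)%N.
Hypothesis L_linear : forall (c : R) p q, L (c *: p + q) = c * L p + L q.
Hypothesis L_div : forall i d p, p \is homog d ->
  r2 * L (mderiv i p) = (d + n.-1)%:R * L (var i * p).

Lemma orthogonal_zonal k m f x : (msize f <= k.+1)%N -> (k < m)%N ->
  L (zonal x m * f) = 0.
Proof.
move=> fk km; rewrite (pihomog_partitionE fk) mulr_sumr (functional_sum L_linear).
apply: big1 => j _.
apply: (orthogonal_harmonic (ltnW n3) L_linear L_div) (pihomogP _ _ _).
- exact: (leq_trans (ltn_ord j) km).
- exact: homog_zonal.
- exact: laplacian_zonal.
Qed.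

(** The statement is proved for all f at once because the recurrence moves the
    factors X_i and |y| ^ 2 from [zonal] to f, while x_i and |x| ^ 2 come out of
    L as coefficients. *)
Lemma moment_zonal_poly m f : exists p : mpoly n R,
  (msize p <= m.+1)%N /\ forall x, L (zonal x m * f) = meval (x 0) p.
Proof.
suff: (forall f, exists p : mpoly n R,
    (msize p <= m.+1)%N /\ forall x, L (zonal x m * f) = meval (x 0) p) /\
  (forall f, exists p : mpoly n R,
    (msize p <= m.+2)%N /\ forall x, L (zonal x m.+1 * f) = meval (x 0) p).
  by case.
have msM d1 d2 (p q : mpoly n R) : (msize p <= d1.+1)%N -> (msize q <= d2.+1)%N ->
    (msize (p * q) <= (d1 + d2).+1)%N.
  move=> hp hq; have [->|p0] := eqVneq p 0; first by rewrite mul0r msize0.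
  have [->|q0] := eqVneq q 0; first by rewrite mulr0 msize0.
  rewrite msizeM//; move: (msize p) (msize q) hp hq => a b; lia.
have ms1 i : (msize (var i) <= 2)%N by rewrite msizeX mdeg1.
have Ldot g d (F : 'rV[R]_n -> mpoly n R) :
    (forall f, exists p : mpoly n R,
      (msize p <= d.+1)%N /\ forall x, L (F x * f) = meval (x 0) p) ->
    exists p : mpoly n R,
    (msize p <= d.+2)%N /\ forall x, L (dot_poly x * F x * g) = meval (x 0) p.
  move=> hF; have /choice[P hP] : forall i, exists p : mpoly n R, (msize p <= d.+1)%N /\
      forall x, L (F x * (var i * g)) = meval (x 0) p by move=> i; exact: hF.
  exists (\sum_i var i * P i); split.
    apply: (leq_trans (msize_sum _ _ _)); apply/bigmax_leqP_seq => i _ _.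
    by rewrite -(add1n d); apply: msM => //; case: (hP i).
  move=> x; rewrite -mulrA /dot_poly mulr_suml (functional_sum L_linear) raddf_sum /=.
  apply: eq_bigr => i _; rewrite mevalM mevalXU -(proj2 (hP i)).
  by rewrite -scalerAl (functionalZ L_linear) [_ * (F x * g)]mulrCA.
have L1 g : exists p : mpoly n R,
    (msize p <= 1)%N /\ forall x : 'rV[R]_n, L (1 * g) = meval (x 0) p.
  exists (mpolyC n (L g)); split; first by rewrite msizeC; case: eqP.
  by move=> x; rewrite mul1r mevalC.
elim: m {f} => [|m [h0 h1]].
  split=> f; first exact: L1.
  have [p [hp hpE]] := Ldot f 0%N (fun=> 1) L1.
  by exists p; split=> // x; rewrite -hpE mulr1.
split=> // f.
have [p1 [sp1 p1E]] := Ldot f _ _ h1.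
have [p0 [sp0 p0E]] := h0 (normsq_poly * f).
have dg0 : (m.+1 + (n - 2))%:R != 0 :> R by rewrite pnatr_eq0.
exists ((m.+1 + (n - 2))%:R^-1 *:
  ((m.+1.*2 + (n - 2))%:R *: p1 - m.+1%:R *: (normsq_poly * p0))).
split.
  apply: (leq_trans (msizeZ_le _ _)); apply: (leq_trans (msizeD_le _ _)).
  rewrite geq_max (leq_trans (msizeZ_le _ _))//= msizeN.
  apply: (leq_trans (msizeZ_le _ _)); rewrite -[m.+2]add2n.
  apply: (msM 2%N m _ _ _ sp0); apply: (leq_trans (msize_sum _ _ _)).
  apply/bigmax_leqP_seq => i _ _; rewrite expr2.
  exact: (msM 1%N 1%N _ _ (ms1 i) (ms1 i)).
move=> x; apply: (mulfI dg0); rewrite mevalZ mulVKf//.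
rewrite -(functionalZ L_linear) scalerAl zonal_rec mulrBl -!scalerAl.
have LB p q : L (p - q) = L p - L q.
  by rewrite (functionalD L_linear) -scaleN1r (functionalZ L_linear) mulN1r.
rewrite LB !(functionalZ L_linear) mevalB !mevalZ mevalM -p1E -p0E.
have -> : meval (x 0) normsq_poly = \sum_i x 0 i ^+ 2.
  by rewrite raddf_sum /=; apply: eq_bigr => i _; rewrite expr2 mevalM !mevalXU.
by rewrite [normsq_poly * _ * f]mulrAC [normsq_poly * f * _]mulrC; ring.
Qed.
End moments.
End harmonic.
(** * The generating function of the zonal harmonics *)

Section generating_function.
Context {R : realType}.
Variables (d : nat) (a b : R) (z : nat -> R).
Hypothesis d0 : (0 < d)%N.
Hypothesis ba : b ^+ 2 <= a.
Hypothesis z0 : z 0%N = 1.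
Hypothesis z1 : z 1%N = b.
Hypothesis zS : forall m, (m.+1 + d)%:R * z m.+2 =
  (m.+1.*2 + d)%:R * b * z m.+1 - m.+1%:R * a * z m.

(** The recurrence makes the quadratic form E k of two consecutive terms decrease:
    E k.+1 <= a * E k.  As E k also bounds (a - b ^ 2) * z k ^ 2 from above and
    E 0 = a - b ^ 2, the claim follows when b ^ 2 < a; when b ^ 2 = a all the E k
    vanish, which forces z m = b ^ m. *)
Lemma zonal_seq_sqr_le m : z m ^+ 2 <= a ^+ m.
Proof.
have a0 : 0 <= a by rewrite (le_trans _ ba)// sqr_ge0.
have aX k : 0 <= a ^+ k by rewrite exprn_ge0.
pose E k := z k.+1 ^+ 2 - 2 * b * z k * z k.+1 + a * z k ^+ 2.
have EE k : E k = (z k.+1 - b * z k) ^+ 2 + (a - b ^+ 2) * z k ^+ 2.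
  by rewrite /E; ring.
have E_le k : E k <= a ^+ k * (a - b ^+ 2).
  elim: k => [|k IH]; first by rewrite EE z0 z1; lra.
  rewrite exprS -mulrA; apply: (le_trans _ (ler_wpM2l a0 IH)).
  have step : (k.+1 + d)%:R * (z k.+2 - b * z k.+1) =
      k.+1%:R * (b * z k.+1 - a * z k).
    by rewrite mulrBr zS -mul2n; ring.
  have -> : a * E k = (b * z k.+1 - a * z k) ^+ 2 + (a - b ^+ 2) * z k.+1 ^+ 2.
    by rewrite /E; ring.
  rewrite EE lerD2r.
  have kd0 : 0 < (k.+1 + d)%:R ^+ 2 :> R by rewrite exprn_gt0// ltr0n.
  rewrite -(ler_pM2l kd0) -exprMn step exprMn ler_wpM2r ?sqr_ge0//.
  by rewrite lerXn2r ?nnegrE ?ler0n// ler_nat leq_addr.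
have [ab|ab] := ltP (b ^+ 2) a.
  have ab0 : 0 < a - b ^+ 2 by rewrite subr_gt0.
  rewrite -(ler_pM2l ab0) [leRHS]mulrC; apply: le_trans (E_le m).
  by rewrite EE lerDr sqr_ge0.
have aE : a = b ^+ 2 by apply/eqP; rewrite eq_le ab ba.
suff -> : z m = b ^+ m by rewrite aE -!exprM mulnC.
elim: m => [|k IH]; first by rewrite z0 expr0.
have := E_le k; rewrite EE aE subrr mulr0 mul0r addr0 => h.
have : (z k.+1 - b * z k) ^+ 2 == 0 by rewrite eq_le h sqr_ge0.
by rewrite sqrf_eq0 subr_eq0 => /eqP ->; rewrite IH exprS.
Qed.

(** The value at 1 of the standard Gegenbauer polynomial of parameter d / 2, by
    which the normalized sequence z has to be multiplied in the generating
    series. *)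
Definition kappa (m : nat) : R := 'C(m + d.-1, m)%:R.

Lemma kappaS m : m.+1%:R * kappa m.+1 = (m + d)%:R * kappa m.
Proof.
rewrite /kappa -!natrM -mul_bin_diag; congr (_ * _)%:R.
by case: d d0 => // e _; rewrite addSn addnS.
Qed.

Lemma kappa_zonal_rec m : m.+2%:R * (kappa m.+2 * z m.+2) =
  (m.+1.*2 + d)%:R * b * (kappa m.+1 * z m.+1) - (m + d)%:R * a * (kappa m * z m).
Proof.
rewrite mulrA kappaS -mulrA mulrCA [_ * z m.+2]mulrC.
rewrite [z m.+2 * _]mulrC zS mulrBr.
have -> : (m + d)%:R * a * (kappa m * z m) =
  ((m + d)%:R * kappa m) * a * z m by ring.
rewrite -kappaS; ring.
Qed.

Local Notation P M := (\sum_(m < M) (kappa m * z m) *: 'X^m : {poly R}).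
Local Notation q := (1 - (2 * b) *: 'X + a *: 'X^2 : {poly R}).

(** The generating function F = q ^ (- d / 2) satisfies q * F' = d (b - a X) F.  For
    a partial sum all the coefficients of this equation cancel by
    [kappa_zonal_rec], except the two that involve the truncation. *)
Lemma partial_sum_ode M : q * (P M.+1)^`() =
  d%:R *: ((b%:P - a *: 'X) * P M.+1)
  - (M.+1%:R * (kappa M.+1 * z M.+1)) *: ('X^M : {poly R})
  + ((M + d)%:R * a * (kappa M * z M)) *: ('X^(M.+1) : {poly R}).
Proof.
elim: M => [|M IH].
  rewrite big_ord_recr big_ord0 /= add0r expr0 alg_polyC derivC mulr0.
  rewrite [1%:R * (kappa 1 * _)]mulrA kappaS /kappa z0 z1 bin0 /= add0n.
  rewrite -!mul_polyC; ring.
rewrite big_ord_recr /= derivD mulrDr IH derivZ derivXn kappa_zonal_rec.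
rewrite -mul2n -!mul_polyC !exprS /=; ring.
Qed.

Definition kernel_error (A : R) (M : nat) : R :=
  2 ^+ d / (1 - A) ^+ (d + 2) * ((M + d)%:R * kappa M * A ^+ M.+1 * (1 + A)).

(** By [partial_sum_ode] the derivative of t |-> (P M.+1).[t] * q.[t] ^ (d / 2) is
    q.[t] ^ (d / 2 - 1) times the two truncation monomials.  On [0, 1] these are
    small by [zonal_seq_sqr_le] and (1 - A) ^ 2 <= q.[t] <= 4, so by the mean
    value theorem this function stays close to its value 1 at t = 0. *)
Lemma kernel_expansion (A : R) M : 0 <= A -> A < 1 -> a = A ^+ 2 ->
  `|\sum_(m < M.+1) kappa m * z m - (Num.sqrt (1 - 2 * b + a) ^+ d)^-1|
    <= kernel_error A M.
Proof.
move=> A0 A1 aA.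
have A10 : 0 < 1 - A by rewrite subr_gt0.
have [bA Ab] : b <= A /\ - A <= b.
  apply/andP; rewrite andbC -ler_norml -(ler_pXn2r (ltn0Sn 1)) ?nnegrE//.
  by rewrite -normrX ger0_norm ?sqr_ge0// -aA.
have qE (t : R) : q.[t] = 1 - 2 * b * t + a * t ^+ 2 by rewrite !hornerE.
have q_ge (t : R) : 0 <= t <= 1 -> (1 - A) ^+ 2 <= q.[t].
  move=> /andP[t0 t1]; rewrite qE aA.
  have h1 : b * t <= A * t by rewrite ler_wpM2r.
  have h2 : 0 <= A * (1 - t) by rewrite mulr_ge0// subr_ge0.
  have h3 : (1 - A) ^+ 2 <= (1 - A * t) ^+ 2.
    by rewrite lerXn2r ?nnegrE//; lra.
  nra.
have q_le (t : R) : 0 <= t <= 1 -> q.[t] <= 2 ^+ 2.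
  move=> /andP[t0 t1]; rewrite qE aA.
  have h1 : - A * t <= b * t by rewrite ler_wpM2r.
  have h2 : 0 <= A * t by rewrite mulr_ge0.
  have h4 : A * t <= 1 by rewrite -[leRHS]mulr1 ler_pM// ltW.
  have h3 : (1 + A * t) ^+ 2 <= 2 ^+ 2.
    by rewrite lerXn2r ?nnegrE//; lra.
  nra.
have q_gt (t : R) : 0 <= t <= 1 -> 0 < q.[t].
  by move=> /q_ge; apply: lt_le_trans; rewrite exprn_gt0.
pose s t := Num.sqrt q.[t].
have s_le (t : R) : 0 <= t <= 1 -> s t <= 2.
  by move=> /q_le h; rewrite /s -[leRHS]ger0_norm// -sqrtr_sqr ler_wsqrtr.
have s_ge (t : R) : 0 <= t <= 1 -> 1 - A <= s t.
  by move=> /q_ge h; rewrite /s -[leLHS]gtr0_norm// -sqrtr_sqr ler_wsqrtr.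
have s_gt (t : R) : 0 <= t <= 1 -> 0 < s t by move=> /s_ge; apply: lt_le_trans.
pose rem t := ((M + d)%:R * a * (kappa M * z M)) * t ^+ M.+1
  - (M.+1%:R * (kappa M.+1 * z M.+1)) * t ^+ M.
have ode (t : R) : q.[t] * (P M.+1)^`().[t] = d%:R * (b - a * t) * (P M.+1).[t] + rem t.
  rewrite -hornerM partial_sum_ode /rem.
  by rewrite !(hornerD, hornerN, hornerZ, hornerM, hornerXn, hornerX, hornerC); ring.
pose psi t := (P M.+1).[t] * s t ^+ d.
have dpsi (t : R) : 0 <= t <= 1 -> is_derive t 1 psi (s t ^+ d / q.[t] * rem t).
  move=> t01; have st := s_gt t t01; have qt := q_gt t t01.
  have ds : is_derive t 1 s ((2 * s t)^-1 * q^`().[t]).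
    by apply: is_derive1_comp; exact: is_derive1_sqrt.
  have -> : psi = horner (P M.+1) * s ^+ d by apply/funext => u; rewrite /= fctE exprfctE.
  apply: is_derive_eq.
  have -> : rem t = q.[t] * (P M.+1)^`().[t] - d%:R * (b - a * t) * (P M.+1).[t].
    by rewrite ode; ring.
  have -> : q^`().[t] = - 2 * (b - a * t).
    by rewrite derivD derivB !derivZ derivC derivX derivXn !hornerE /=; ring.
  have sq : q.[t] = s t ^+ 2 by rewrite sqr_sqrtr// ltW.
  rewrite sq exprfctE -![_ *: (_ : R^o)]/(_ * _).
  have -> : s t ^+ d = s t * s t ^+ d.-1 by rewrite -exprS prednK.
  have s0 : s t != 0 by rewrite gt_eqF.
  by field.
have rem_le (t : R) : 0 <= t <= 1 ->
    `|rem t| <= (M + d)%:R * kappa M * A ^+ M.+1 * (1 + A).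
  move=> /andP[t0 t1].
  have zA k : `|z k| <= A ^+ k.
    rewrite -(ler_pXn2r (ltn0Sn 1)) ?nnegrE ?exprn_ge0// -normrX ger0_norm ?sqr_ge0//.
    by rewrite -exprM mulnC exprM -aA zonal_seq_sqr_le.
  have tX k : `|t ^+ k| <= 1 by rewrite ger0_norm ?exprn_ge0// exprn_ile1.
  have k0 k : 0 <= kappa k by rewrite ler0n.
  rewrite /rem [M.+1%:R * _]mulrA kappaS (le_trans (ler_normB _ _))// mulrDr mulr1 addrC.
  have h k u v w : 0 <= u -> `|v| <= A ^+ k -> `|w| <= 1 -> `|u * v * w| <= u * A ^+ k.
    move=> u0 hv hw; rewrite 2!normrM (ger0_norm u0) -[leRHS]mulr1.
    by rewrite ler_pM ?mulr_ge0// ler_wpM2l.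
  apply: lerD; first by apply: h => //; rewrite mulr_ge0// ler0n.
  have -> : (M + d)%:R * kappa M * A ^+ M.+1 * A = (M + d)%:R * a * kappa M * A ^+ M.
    by rewrite aA exprS; ring.
  rewrite mulrA; apply: h => //.
  by rewrite !mulr_ge0// ?ler0n// aA sqr_ge0.
have psi_le : `|psi 1 - psi 0| <= 2 ^+ d / (1 - A) ^+ 2 *
    ((M + d)%:R * kappa M * A ^+ M.+1 * (1 + A)).
  have [t||c] := @MVT_segment _ psi (fun t => s t ^+ d / q.[t] * rem t) 0 1 ler01.
  - by rewrite in_itv /= => /andP[/ltW t0 /ltW t1]; apply: dpsi; rewrite t0.
  - apply: derivable_within_continuous => t; rewrite in_itv /= => t01.
    by have [] := dpsi t t01.
  rewrite in_itv /= => c01 ->; rewrite subr0 mulr1 normrM.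
  have sc := s_gt _ c01; have qc := q_gt _ c01.
  rewrite ler_pM ?rem_le// ger0_norm; last by rewrite divr_ge0 ?exprn_ge0// ltW.
  rewrite ler_pM ?exprn_ge0 ?invr_ge0 ?(ltW sc) ?(ltW qc)//.
    by rewrite lerXn2r ?nnegrE ?(ltW sc)// s_le.
  by rewrite lef_pV2 ?posrE ?exprn_gt0// q_ge.
have psi0 : psi 0 = 1.
  rewrite /psi /s qE !(mulr0, expr0n) /= subr0 addr0 sqrtr1 expr1n mulr1.
  rewrite big_ord_recl hornerD hornerZ expr0 hornerC /kappa bin0 z0 !mulr1.
  rewrite horner_sum big1 ?addr0// => i _.
  by rewrite hornerZ hornerXn /= exprS mul0r mulr0.
have psi1 : psi 1 = (\sum_(m < M.+1) kappa m * z m) * s 1 ^+ d.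
  rewrite /psi horner_sum; congr (_ * _); apply: eq_bigr => i _.
  by rewrite hornerZ hornerXn expr1n mulr1.
have -> : 1 - 2 * b + a = q.[1] by rewrite qE expr1n !mulr1.
rewrite -/(s 1).
have i1 : 0 <= (1 : R) <= 1 by rewrite ler01 lexx.
have s1 : 0 < s 1 ^+ d by rewrite exprn_gt0// s_gt.
rewrite -(ler_pM2r s1) -[X in _ * X <= _]gtr0_norm// -normrM mulrBl mulVf ?gt_eqF//.
move: psi_le; rewrite psi0 psi1 => /le_trans; apply.
have rem0 : 0 <= (M + d)%:R * kappa M * A ^+ M.+1 * (1 + A).
  by rewrite !mulr_ge0 ?exprn_ge0 ?ler0n ?addr_ge0.
have sA : (1 - A) ^+ d <= s 1 ^+ d.
  by rewrite lerXn2r ?nnegrE ?(ltW A10) ?(ltW (s_gt _ i1))// s_ge.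
have -> : kernel_error A M * s 1 ^+ d =
    2 ^+ d / (1 - A) ^+ 2 * ((M + d)%:R * kappa M * A ^+ M.+1 * (1 + A)) *
    (s 1 ^+ d / (1 - A) ^+ d).
  by rewrite /kernel_error exprD invfM; ring.
rewrite ler_peMr//; last by rewrite ler_pdivlMr ?mul1r ?exprn_gt0.
by rewrite mulr_ge0// divr_ge0 ?exprn_ge0// ltW.
Qed.

(** The binomial coefficient in [kappa] is absorbed by half of the geometric
    factor: writing A = B ^ 2, the product 'C(M + d, d) * B ^ M stays bounded, and
    B ^ M tends to 0. *)
Lemma kernel_error_cvg0 (A : R) : 0 <= A -> A < 1 -> kernel_error A @ \oo --> 0.
Proof.
move=> A0 A1; pose B := Num.sqrt A.
have BB : A = B ^+ 2 by rewrite sqr_sqrtr.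
have B0 : 0 <= B := sqrtr_ge0 _.
have B1 : B < 1 by rewrite -sqrtr1 ltr_sqrt.
have B10 : 0 < (1 - B) ^+ d by rewrite exprn_gt0// subr_gt0.
(* a single term of the binomial expansion of (B + (1 - B)) ^ (M + d) = 1 *)
have bin_le M : ('C(M + d, d))%:R * B ^+ M <= ((1 - B) ^+ d)^-1.
  rewrite -[leRHS]mul1r ler_pdivlMr//.
  have h1 : (B + (1 - B)) ^+ (M + d) = 1 :> R by rewrite addrC subrK expr1n.
  rewrite -[leRHS]h1.
  have dMd : (d < (M + d).+1)%N by rewrite ltnS leq_addl.
  rewrite [leRHS]exprDn (bigD1 (Ordinal dMd))//= addnK -[leLHS]mulrA mulr_natl lerDl.
  apply: sumr_ge0 => i _; rewrite mulrn_wge0// mulr_ge0 ?exprn_ge0//.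
  by rewrite subr_ge0 ltW.
have kE M : (M + d)%:R * kappa M = d%:R * ('C(M + d, d))%:R.
  have [e de] : exists e, d = e.+1 by exists d.-1; rewrite prednK.
  rewrite /kappa -!natrM de addnS -mul_bin_diag /=; congr (_ * _)%:R.
  by rewrite -(bin_sub (leq_addl M e)) addnK.
pose c := 2 ^+ d / (1 - A) ^+ (d + 2) * (d%:R * ((1 - B) ^+ d)^-1 * (1 + A)).
have A10 : 0 < 1 - A by rewrite subr_gt0.
have Ap : 0 <= 1 + A by rewrite addr_ge0.
apply: (@squeeze_cvgr _ _ _ _ (fun=> 0) (fun M => c * B ^+ M)).
- near=> M; rewrite /kernel_error kE; apply/andP; split.
    by rewrite !mulr_ge0 ?invr_ge0 ?exprn_ge0 ?ler0n// ltW.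
  have -> : c * B ^+ M = 2 ^+ d / (1 - A) ^+ (d + 2) *
      (d%:R * (((1 - B) ^+ d)^-1 * B ^+ M) * (1 + A)) by rewrite /c; ring.
  rewrite -[_ * 'C(_, _)%:R * _]mulrA ler_wpM2l//.
    by rewrite divr_ge0 ?exprn_ge0// ltW.
  rewrite ler_wpM2r// ler_wpM2l ?ler0n//.
  have AB : A ^+ M.+1 <= B ^+ M * B ^+ M.
    have -> : B ^+ M * B ^+ M = A ^+ M by rewrite BB -exprM mulnC exprM expr2.
    rewrite exprS.
    by rewrite -[leRHS]mul1r ler_wpM2r ?exprn_ge0// ltW.
  apply: (le_trans (ler_wpM2l _ AB)); rewrite ?ler0n//.
  by rewrite mulrA ler_wpM2r ?exprn_ge0.
- exact: cvg_cst.
- rewrite -[X in _ --> X](mulr0 c); apply: cvgM; first exact: cvg_cst.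
  by apply: cvg_expr; rewrite ger0_norm.
Unshelve. all: by end_near. Qed.

End generating_function.
(** * Wallis integrals *)

Lemma cvg_exprn {R : realType} {T : Type} {F : set_system T} {FF : Filter F}
  (f : T -> R) (l : R) (n : nat) :
  f x @[x --> F] --> l -> f x ^+ n @[x --> F] --> l ^+ n.
Proof.
move=> fl; apply: (cvg_comp _ (fun y : R => y ^+ n) fl).
exact: exprn_continuous.
Qed.

Section wallis.
Context {R : realType}.
Local Notation mu := (@lebesgue_measure R).
Local Notation h := (pi / 2 : R).

Definition wallis_fun (a b : nat) : R -> R := fun t => sin t ^+ a * cos t ^+ b.

Definition wallis (a b : nat) : R := \int[mu]_(t in `[- h, h]) wallis_fun a b t.

Let h0 : 0 < h.
Proof. by rewrite divr_gt0// pi_gt0. Qed.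

Let Nhh : - h < h.
Proof. by rewrite gtrN. Qed.

Lemma continuous_wallis_fun a b : continuous (wallis_fun a b).
Proof.
by move=> t; apply: cvgM; apply: cvg_exprn; [exact: continuous_sin|exact: continuous_cos].
Qed.

Lemma integrable_segment (f : R -> R) (c d : R) : continuous f ->
  mu.-integrable `[c, d] (EFin \o f).
Proof.
move=> cf; apply: continuous_compact_integrable; first exact: segment_compact.
exact: continuous_subspaceT.
Qed.

Lemma integrable_wallis_fun a b :
  mu.-integrable `[- h, h] (EFin \o wallis_fun a b).
Proof. exact/integrable_segment/continuous_wallis_fun. Qed.

Lemma wallis_FTC (F f : R -> R) : continuous f ->
  (forall t : R, is_derive t 1 F (f t)) ->
  \int[mu]_(t in `[- h, h]) f t = F h - F (- h).
Proof.
move=> cf dF; rewrite /Rintegral.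
have cF : continuous F.
  by move=> t; apply/differentiable_continuous/derivable1_diffP; case: (dF t).
rewrite (@continuous_FTC2 _ f F)//.
- exact: continuous_subspaceT.
- split=> [t _||]; first by case: (dF t).
  + exact/cvg_at_right_filter/cF.
  + exact/cvg_at_left_filter/cF.
- by move=> t _; rewrite derive1E; case: (dF t).
Qed.

Lemma wallisD2 a b : wallis a b = wallis a.+2 b + wallis a b.+2.
Proof.
rewrite /wallis -RintegralD//; try exact: integrable_wallis_fun.
apply: eq_Rintegral => t _; rewrite /wallis_fun !exprSr.
by rewrite -[LHS]mulr1 -(cos2Dsin2 t); ring.
Qed.

(** The difference of the two sides is the integral of the derivative of
    sin ^ (a + 1) * cos ^ (b + 1), which vanishes at both ends of the interval. *)
Lemma wallis_parts a b : a.+1%:R * wallis a b.+2 = b.+1%:R * wallis a.+2 b.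
Proof.
have intW c d := integrable_wallis_fun c d.
have cW c d (k : R) : continuous (fun t : R => k * wallis_fun c d t).
  by move=> t; apply: cvgM; [exact: cvg_cst|exact: continuous_wallis_fun].
have intZ c d (k : R) := integrable_segment (- h) h (cW c d k).
apply/eqP; rewrite -subr_eq0 /wallis -!RintegralZl// -RintegralB//=.
pose F (t : R) := sin t ^+ a.+1 * cos t ^+ b.+1.
have dF (t : R) : is_derive t 1 F
    (a.+1%:R * wallis_fun a b.+2 t - b.+1%:R * wallis_fun a.+2 b t).
  have -> : F = (sin ^+ a.+1) * (cos ^+ b.+1).
    by apply/funext => u; rewrite /F !fctE.
  apply: is_derive_eq.
  rewrite !exprfctE -![_ *: (_ : R^o)]/(_ * _) /wallis_fun /= !exprS; ring.
rewrite (wallis_FTC _ dF); last by move=> t; apply: cvgB; exact: cW.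
by rewrite /F cosN cos_pihalf expr0n !mulr0 subrr.
Qed.

Lemma wallis1 b : wallis 1 b = 0.
Proof.
have b0 : b.+1%:R != 0 :> R by rewrite pnatr_eq0.
pose F (t : R) := - (b.+1%:R)^-1 * cos t ^+ b.+1.
have dF (t : R) : is_derive t 1 F (wallis_fun 1 b t).
  have -> : F = - (b.+1%:R)^-1 *: (cos ^+ b.+1).
    by apply/funext => u; rewrite /F !fctE.
  apply: is_derive_eq.
  by rewrite -![_ *: (_ : R^o)]/(_ * _) /wallis_fun /=; field.
rewrite /wallis (wallis_FTC _ dF); last exact: continuous_wallis_fun.
by rewrite /F cosN subrr.
Qed.

Lemma wallis_sin2 a b : (a + b + 2)%:R * wallis a.+2 b = a.+1%:R * wallis a b.
Proof. by rewrite [wallis a b]wallisD2 mulrDr wallis_parts; ring. Qed.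

Lemma wallis_cos2 a b : (a + b + 2)%:R * wallis a b.+2 = b.+1%:R * wallis a b.
Proof. by rewrite [wallis a b]wallisD2 mulrDr -wallis_parts; ring. Qed.

End wallis.
(** * Moments of powers of sqrt (A - t ^ 2) *)

Lemma measurable_inv {R : realType} : measurable_fun setT (fun x : R => x^-1).
Proof.
rewrite -(setvU [set (0 : R)]).
apply/measurable_funU; [exact: measurableC|exact: measurable_set1|].
split; last exact: measurable_fun_set1.
apply: open_continuous_measurable_fun; first exact/closed_openC/closed_eq.
by move=> x; rewrite inE /= => /eqP; exact: inv_continuous.
Qed.

Lemma measurable_sqrt {R : realType} : measurable_fun setT (@Num.sqrt R).
Proof. by apply: continuous_measurable_fun; exact: sqrt_continuous. Qed.

Section arcsine_substitution.
Context {R : realType}.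
Local Notation mu := (@lebesgue_measure R).
Local Notation h := (pi / 2 : R).

(** The power b - 1 of sqrt (A - t ^ 2), with b a natural number.  As the inverse
    of 0 is 0, it vanishes for t ^ 2 >= A, so that no indicator function is needed
    when integrating over the whole line. *)
Definition semicircle_fun (A : R) (b : nat) (t : R) : R :=
  Num.sqrt (A - t ^+ 2) ^+ b / Num.sqrt (A - t ^+ 2).

Lemma semicircle_fun_ge0 A b t : 0 <= semicircle_fun A b t.
Proof. by rewrite divr_ge0 ?exprn_ge0 ?sqrtr_ge0. Qed.

Lemma semicircle_fun0 A b t : A <= t ^+ 2 -> semicircle_fun A b t = 0.
Proof.
by move=> At; rewrite /semicircle_fun [X in _ / X]ler0_sqrtr ?invr0 ?mulr0// subr_le0.
Qed.

Lemma measurable_semicircle_fun A b :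
  measurable_fun setT (semicircle_fun A b).
Proof.
have ms : measurable_fun [set: R] (fun t => Num.sqrt (A - t ^+ 2)).
  apply: measurableT_comp; first exact: measurable_sqrt.
  by apply: measurable_funB => //; exact: measurable_funX.
apply: measurable_funM; first exact: measurable_funX.
by apply: measurableT_comp => //; exact: measurable_inv.
Qed.

Lemma itv_oo_bigcup (x : R) (u : R^nat) : u @ \oo --> x ->
  (forall n, u n < x) -> `]- x, x[%classic = \bigcup_n `[- u n, u n]%classic.
Proof.
move=> ux u_lt; apply/seteqP; split => [t /=|t [n _] /=]; rewrite !in_itv /=.
  rewrite -ltr_norml => tx; have : \forall n \near \oo, `|t| < u n.
    by apply: cvgr_gt tx; exact: ux.
  by case=> n _ /(_ n (leqnn n)) /ltW tn; exists n => //=; rewrite in_itv /= -ler_norml.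
by rewrite -ler_norml -ltr_norml => /le_lt_trans; apply.
Qed.

Section substitution.
Variables (A : R) (b : nat) (q : R -> R).
Hypothesis A0 : 0 < A.
Hypothesis cq : continuous q.
Hypothesis q0 : forall t, t ^+ 2 <= A -> 0 <= q t.
Let r := Num.sqrt A.
Let r0 : 0 < r. Proof. by rewrite sqrtr_gt0. Qed.
Let rr : A = r ^+ 2. Proof. by rewrite sqr_sqrtr// ltW. Qed.

Lemma arcsine_substitution_segment e : 0 <= e -> e < h ->
  (\int[mu]_(t in `[(- (r * sin e))%R, (r * sin e)%R]) (q t * semicircle_fun A b t)%:E =
   \int[mu]_(t in `[(- e)%R, e]) (q (r * sin t) * (r * cos t) ^+ b)%:E)%E.
Proof.
move=> e0 eh.
have NhE t : - e <= t <= e -> - h < t < h.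
  move=> /andP[et te]; rewrite (lt_le_trans _ et) ?ltrN2//.
  exact: le_lt_trans te eh.
have d1 (t : R) : is_derive t 1 (fun t => r * sin t) (r * cos t).
  exact: (is_deriveZ r (is_derive_sin t)).
have dE : (fun t => r * sin t)^`()%classic = (fun t => r * cos t).
  by apply/funext => t; rewrite derive1E; case: (d1 t).
have cE : continuous (fun t : R => r * cos t).
  by move=> t; apply: cvgM; [exact: cvg_cst|exact: continuous_cos].
have cS : continuous (fun t : R => r * sin t).
  by move=> t; apply: cvgM; [exact: cvg_cst|exact: continuous_sin].
rewrite -mulrN -sinN (@integration_by_substitution_increasing _ (fun t => r * sin t)).
- apply: eq_integral => t; rewrite inE /= in_itv /= => /NhE th; congr EFin.
  rewrite dE /semicircle_fun mulrfctE /=.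
  have ct : 0 < cos t by exact: cos_gt0_pihalf.
  have -> : Num.sqrt (A - (r * sin t) ^+ 2) = r * cos t.
    rewrite rr exprMn -{1}[r ^+ 2]mulr1 -mulrBr -cos2sin2 -exprMn sqrtr_sqr.
    by rewrite ger0_norm// mulr_ge0// ltW.
  by rewrite -mulrA divfK// gt_eqF// mulr_gt0.
- by rewrite lerNl (le_trans _ e0)// oppr_le0.
- move=> x y; rewrite !in_itv /= => /NhE /andP[hx xh] /NhE /andP[hy yh] xy.
  by rewrite ltr_pM2l// ltr_sin// in_itv /= ?(ltW hx) ?(ltW hy) ltW.
- by move=> x _; rewrite dE; exact: cE.
- by rewrite dE; apply/cvg_ex; eexists; apply: cvg_at_right_filter; exact: cE.
- by rewrite dE; apply/cvg_ex; eexists; apply: cvg_at_left_filter; exact: cE.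
- split=> [t _||]; first by case: (d1 t).
  + by apply: cvg_at_right_filter; exact: cS.
  + by apply: cvg_at_left_filter; exact: cS.
- apply: continuous_in_subspaceT => t; rewrite inE /= in_itv /= sinN mulrN.
  move=> /andP[t1 t2].
  have rs : r * sin e < r.
    rewrite -[ltRHS]mulr1 ltr_pM2l// -sin_pihalf ltr_sin// in_itv /=
      ?lexx ?(ltW eh) ?andbT.
      by rewrite (le_trans _ e0)// oppr_le0 ltW// (le_lt_trans e0).
    by rewrite ge0_cp// divr_ge0// pi_ge0.
  have At : 0 < A - t ^+ 2.
    by rewrite rr subr_sqr mulr_gt0//; lra.
  have cs : Num.sqrt (A - x ^+ 2) @[x --> t] --> Num.sqrt (A - t ^+ 2).
    apply: (cvg_comp (fun t : R => A - t ^+ 2) Num.sqrt); last exact: sqrt_continuous.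
    by apply: cvgB; [exact: cvg_cst|exact: exprn_continuous].
  apply: cvgM; first exact: cq.
  apply: cvgM; first exact: cvg_exprn.
  by apply: cvgV => //; rewrite gt_eqF// sqrtr_gt0.
Qed.

(** For b = 0 the weight is unbounded at the ends of [-sqrt A, sqrt A].  The
    substitution t = sqrt A * sin s is therefore made on smaller closed intervals,
    and the nonnegativity of q allows passing to the limit by monotone
    convergence. *)
Lemma arcsine_substitution :
  (\int[mu]_t (q t * semicircle_fun A b t)%:E =
   \int[mu]_(t in `[(- h)%R, h]) (q (r * sin t) * (r * cos t) ^+ b)%:E)%E.
Proof.
pose e (n : nat) : R := h - h * n.+1%:R^-1.
have h0 : 0 < h by rewrite divr_gt0// pi_gt0.
have e_lt n : e n < h by rewrite ltrBlDr ltrDl mulr_gt0// invr_gt0.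
have e_ge n : 0 <= e n.
  by rewrite subr_ge0 -[leRHS]mulr1 ler_pM2l// invf_le1// ler1n.
have e_cvg : e @ \oo --> h.
  rewrite -[X in _ --> X]subr0 -[X in _ - X](mulr0 h); apply: cvgB; first exact: cvg_cst.
  by apply: cvgM; [exact: cvg_cst|exact: cvg_harmonic].
have e_nd : {homo e : n m / (n <= m)%N >-> n <= m}.
  move=> n m nm; rewrite lerD2l lerN2 ler_pM2l// lef_pV2 ?posrE ?ltr0n//.
  by rewrite ler_nat.
have re_cvg : (fun n => r * sin (e n)) @ \oo --> r.
  rewrite -[X in _ --> X]mulr1 -sin_pihalf; apply: cvgM; first exact: cvg_cst.
  by apply: (cvg_comp _ _ e_cvg); exact: continuous_sin.
have in_h n : e n \in `[- h, h].
  by rewrite in_itv /= (ltW (e_lt n)) andbT (le_trans _ (e_ge n))// oppr_le0 ltW.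
have in_hh : h \in `[- h, h] by rewrite in_itv /= lexx andbT ge0_cp// ltW.
have re_lt n : r * sin (e n) < r.
  by rewrite -[ltRHS]mulr1 ltr_pM2l// -sin_pihalf ltr_sin.
have re_nd : {homo (fun n => r * sin (e n)) : n m / (n <= m)%N >-> n <= m}.
  by move=> n m nm; rewrite ler_pM2l// leNgt ltr_sin// -leNgt e_nd.
have nd (u : nat -> R) : {homo u : n m / (n <= m)%N >-> n <= m} ->
    nondecreasing_seq (fun n => `[- u n, u n]%classic).
  move=> u_nd n m nm; rewrite subsetEset => t /=; rewrite !in_itv /= -!ler_norml.
  by move=> /le_trans; apply; exact: u_nd.
have mq : measurable_fun setT q by exact: continuous_measurable_fun.
have cg : continuous (fun t : R => q (r * sin t) * (r * cos t) ^+ b).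
  move=> t; apply: cvgM.
    apply: (cvg_comp (fun t : R => r * sin t) q); last exact: cq.
    by apply: cvgM; [exact: cvg_cst|exact: continuous_sin].
  by apply: cvg_exprn; apply: cvgM; [exact: cvg_cst|exact: continuous_cos].
have mf : measurable_fun setT (fun t : R => (q t * semicircle_fun A b t)%:E).
  apply/measurable_EFinP; apply: measurable_funM => //.
  exact: measurable_semicircle_fun.
have mg : measurable_fun setT (fun t : R => (q (r * sin t) * (r * cos t) ^+ b)%:E).
  by apply/measurable_EFinP; exact: continuous_measurable_fun.
transitivity (\int[mu]_(t in `](- r)%R, r[) (q t * semicircle_fun A b t)%:E)%E.
  rewrite [RHS]integral_mkcond; apply: eq_integral => t _.
  rewrite patchE; case: ifPn => //; rewrite notin_setE /= in_itv /= -ltr_norml => /negP.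
  rewrite -leNgt => rt; rewrite semicircle_fun0 ?mulr0//.
  by rewrite rr -[leRHS]real_normK ?num_real// lerXn2r ?nnegrE ?(ltW r0).
transitivity (\int[mu]_(t in `](- h)%R, h[)
    (q (r * sin t) * (r * cos t) ^+ b)%:E)%E; last first.
  by rewrite [RHS]integral_itv_bndoo//; exact: measurable_funTS.
rewrite (itv_oo_bigcup re_cvg re_lt) (itv_oo_bigcup e_cvg e_lt).
pose u n := (\int[mu]_(t in `[(- (r * sin (e n)))%R, (r * sin (e n))%R])
  (q t * semicircle_fun A b t)%:E)%E.
rewrite -[LHS](@cvg_lim _ (@ereal_hausdorff R) _ (u @ \oo) _ id).
  apply: cvg_lim => //.
  have -> : u = (fun n => \int[mu]_(t in `[(- e n)%R, e n])
      (q (r * sin t) * (r * cos t) ^+ b)%:E)%E.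
    by apply/funext => n; exact: arcsine_substitution_segment.
  apply: ge0_nondecreasing_set_cvg_integral.
  + exact: nd.
  + by move=> n; exact: measurable_itv.
  + by move=> n; exact: measurable_funTS.
  + move=> n t /=; rewrite in_itv /= -ler_norml => tn.
    have ct : 0 < cos t.
      by apply: cos_gt0_pihalf; rewrite -ltr_norml (le_lt_trans tn).
    rewrite lee_fin mulr_ge0 ?exprn_ge0 ?mulr_ge0 ?(ltW r0) ?(ltW ct)// q0//.
    by rewrite exprMn -rr ler_piMr ?(ltW A0)// sin2cos2 gerBl sqr_ge0.
apply: ge0_nondecreasing_set_cvg_integral.
- exact: nd.
- by move=> n; exact: measurable_itv.
- by move=> n; exact: measurable_funTS.
- move=> n t /=; rewrite in_itv /= -ler_norml => tn.
  rewrite lee_fin mulr_ge0 ?semicircle_fun_ge0// q0//.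
  rewrite rr -[leLHS]real_normK ?num_real// lerXn2r ?nnegrE ?(ltW r0)//.
  by rewrite (le_trans tn)// ltW.
Qed.

End substitution.

(** The power t ^ a changes sign, but it is the difference of
    sqrt A ^ a + t ^ a and sqrt A ^ a, which are nonnegative on
    [-sqrt A, sqrt A] and to which [arcsine_substitution] applies.  The factor
    sqrt A ^ (a + b + 1) / sqrt A, rather than sqrt A ^ (a + b), makes the formula
    right also for A <= 0, where both sides are 0. *)
Lemma semicircle_moment (a b : nat) (A : R) :
  mu.-integrable setT (fun t => (t ^+ a * semicircle_fun A b t)%:E) /\
  \int[mu]_t (t ^+ a * semicircle_fun A b t) =
    wallis a b * (Num.sqrt A ^+ (a + b).+1 / Num.sqrt A).
Proof.
have [A0|A0] := leP A 0.
  have z t : t ^+ a * semicircle_fun A b t = 0.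
    by rewrite semicircle_fun0 ?mulr0// (le_trans A0)// sqr_ge0.
  split; first by under eq_fun do rewrite z; exact: integrable0.
  rewrite /Rintegral; under eq_integral do rewrite z.
  by rewrite integral0 (ler0_sqrtr A0) invr0 !mulr0.
pose r := Num.sqrt A.
have r0 : 0 < r by rewrite sqrtr_gt0.
have rA : A = r ^+ 2 by rewrite sqr_sqrtr// ltW.
have r0' : r != 0 by rewrite gt_eqF.
have tr (t : R) : t ^+ 2 <= A -> `|t ^+ a| <= r ^+ a.
  rewrite rA -[X in X <= _]real_normK ?num_real// => h1.
  by rewrite normrX lerXn2r ?nnegrE ?(ltW r0)// -(ler_pXn2r (ltn0Sn 1)) ?nnegrE ?(ltW r0).
have subst (q : R -> R) : continuous q -> (forall t : R, t ^+ 2 <= A -> 0 <= q t) ->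
    mu.-integrable setT (fun t => (q t * semicircle_fun A b t)%:E) /\
    \int[mu]_t (q t * semicircle_fun A b t) =
    \int[mu]_(t in `[- h, h]) (q (r * sin t) * (r * cos t) ^+ b).
  move=> cq q0; have E := @arcsine_substitution A b q A0 cq q0.
  split; last by rewrite /Rintegral E.
  have cg : continuous (fun t : R => q (r * sin t) * (r * cos t) ^+ b).
    move=> t; apply: cvgM.
      apply: (cvg_comp (fun t : R => r * sin t) q); last exact: cq.
      by apply: cvgM; [exact: cvg_cst|exact: continuous_sin].
    by apply: cvg_exprn; apply: cvgM; [exact: cvg_cst|exact: continuous_cos].
  apply/integrableP; split.
    apply/measurable_EFinP; apply: measurable_funM; last exact: measurable_semicircle_fun.
    exact: continuous_measurable_fun.
  have ge0 t : 0 <= q t * semicircle_fun A b t.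
    have [At|At] := leP A (t ^+ 2); first by rewrite semicircle_fun0 ?mulr0.
    by rewrite mulr_ge0 ?semicircle_fun_ge0// q0// ltW.
  under eq_integral => t _ do rewrite gee0_abs ?lee_fin//.
  rewrite E; have /integrableP[mg] := integrable_segment (- h) h cg.
  apply: le_lt_trans; apply: (le_trans (lee_abs _)).
  exact: le_abse_integral.
have [|t At|ic ec] := subst (fun=> r ^+ a); first exact: cst_continuous.
  by rewrite exprn_ge0// ltW.
have [t|t At|iw ew] := subst (fun t => r ^+ a + t ^+ a).
- by apply: cvgD; [exact: cvg_cst|exact: exprn_continuous].
- by have := tr t At; rewrite ler_norml => /andP[]; rewrite -subr_ge0 opprK addrC.
have E t : t ^+ a * semicircle_fun A b t =
  (r ^+ a + t ^+ a) * semicircle_fun A b t - r ^+ a * semicircle_fun A b t by ring.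
split.
  under eq_fun do rewrite E EFinB; exact: integrableB.
under eq_Rintegral do rewrite E.
rewrite RintegralB// ew ec -RintegralB//=.
- under eq_Rintegral => t _.
    rewrite (_ : _ - _ = r ^+ (a + b) * wallis_fun a b t).
      over.
    rewrite /wallis_fun !exprMn exprD; ring.
  rewrite RintegralZl//; last exact: integrable_wallis_fun.
  by rewrite mulrC exprSr mulfK.
- apply: integrable_segment => t.
  apply: cvgM.
    apply: cvgD; first exact: cvg_cst.
    by apply: cvg_exprn; apply: cvgM; [exact: cvg_cst|exact: continuous_sin].
  by apply: cvg_exprn; apply: cvgM; [exact: cvg_cst|exact: continuous_cos].
- apply: integrable_segment => t; apply: cvgM; first exact: cvg_cst.
  by apply: cvg_exprn; apply: cvgM; [exact: cvg_cst|exact: continuous_cos].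
Qed.

End arcsine_substitution.
(** * Moments of powers of sqrt (A - |u| ^ 2) *)

Section ball_moments.
Context {R : realType}.
Local Notation RT := (measurableTypeR R).

Lemma integrable_dominated d (T : measurableType d) (mu : {measure set T -> \bar R})
    (f g : T -> R) : measurable_fun setT (f : T -> RT) ->
  (forall x, `|f x| <= g x) -> mu.-integrable setT (EFin \o g) ->
  mu.-integrable setT (EFin \o f).
Proof.
move=> mf fg; apply: le_integrable => //; first exact/measurable_EFinP.
move=> x _; rewrite /= lee_fin (le_trans (fg x))//; exact: ler_norm.
Qed.

Lemma integrable_scale d (T : measurableType d)
    (mu : {measure set T -> \bar R}) (k : R) (g : T -> R) :
  mu.-integrable setT (EFin \o g) ->
  mu.-integrable setT (EFin \o (fun t => k * g t)).
Proof.
move=> ig; rewrite (_ : _ \o _ = (fun t => k%:E * (EFin \o g) t)%E).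
  exact: integrableZl.
by apply/funext => t; rewrite /= EFinM.
Qed.

Definition tuple_normsq (m : nat) (u : m.-tuple RT) : R :=
  \sum_(i < m) tnth u i ^+ 2.

(** The power c - 1 of the height sqrt (A - |u| ^ 2) of a graph over the ball
    |u| ^ 2 < A, and 0 outside that ball since the inverse of 0 is 0. *)
Definition ball_weight (m c : nat) (A : R) (u : m.-tuple RT) : R :=
  Num.sqrt (A - tuple_normsq u) ^+ c / Num.sqrt (A - tuple_normsq u).

Definition ball_fun (m : nat) (beta : nat -> nat) (c : nat) (A : R)
    (u : m.-tuple RT) : R :=
  (\prod_(i < m) tnth u i ^+ beta i) * ball_weight c A u.

(** The value of the integral of [ball_fun m beta c 1] over R ^ m. *)
Fixpoint ball_coef (m : nat) (beta : nat -> nat) (c : nat) : R :=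
  if m is m1.+1 then
    ball_coef m1 (fun i => beta i.+1) c *
      wallis (beta 0%N) (\sum_(i < m1) (beta i.+1).+1 + c)
  else 1.

Lemma tnth_cons0 m (t : RT) (u : m.-tuple RT) : tnth (tuple_cons (t, u)) ord0 = t.
Proof. by []. Qed.

Lemma tnth_consS m (t : RT) (u : m.-tuple RT) i :
  tnth (tuple_cons (t, u)) (lift ord0 i) = tnth u i.
Proof. by rewrite /tuple_cons /= !(tnth_nth 0). Qed.

Lemma tuple_normsq_cons m (t : RT) (u : m.-tuple RT) :
  tuple_normsq (tuple_cons (t, u)) = t ^+ 2 + tuple_normsq u.
Proof.
rewrite /tuple_normsq big_ord_recl tnth_cons0; congr (_ + _).
by apply: eq_bigr => i _; rewrite tnth_consS.
Qed.

Lemma ball_weight_cons m c A (t : RT) (u : m.-tuple RT) :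
  ball_weight c A (tuple_cons (t, u)) = ball_weight c (A - t ^+ 2) u.
Proof. by rewrite /ball_weight tuple_normsq_cons opprD addrA. Qed.

Lemma ball_fun_cons m beta c A (t : RT) (u : m.-tuple RT) :
  ball_fun beta c A (tuple_cons (t, u)) =
  t ^+ beta 0%N * ball_fun (fun i => beta i.+1) c (A - t ^+ 2) u.
Proof.
rewrite /ball_fun ball_weight_cons big_ord_recl tnth_cons0 mulrA.
by under eq_bigr do rewrite tnth_consS.
Qed.

Lemma measurable_tuple_normsq m :
  measurable_fun setT (@tuple_normsq m : _ -> RT).
Proof.
apply: measurable_sum => i; apply: measurable_funX; exact: measurable_tnth.
Qed.

Lemma measurable_ball_weight m c A :
  measurable_fun setT (@ball_weight m c A : _ -> RT).
Proof.
have ms : measurable_fun setT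
    (fun u : m.-tuple RT => Num.sqrt (A - tuple_normsq u) : RT).
  apply: measurableT_comp; first exact: measurable_sqrt.
  by apply: measurable_funB => //; exact: measurable_tuple_normsq.
apply: measurable_funM; first exact: measurable_funX.
by apply: measurableT_comp => //; exact: measurable_inv.
Qed.

Lemma measurable_ball_fun m beta c A :
  measurable_fun setT (@ball_fun m beta c A : _ -> RT).
Proof.
apply: measurable_funM; last exact: measurable_ball_weight.
by apply: measurable_prod => i _; apply: measurable_funX; exact: measurable_tnth.
Qed.

Lemma measurable_EFin_ball_fun m beta c A :
  measurable_fun setT (EFin \o @ball_fun m beta c A).
Proof. by apply/measurable_EFinP; exact: measurable_ball_fun. Qed.

Lemma ball_weight_ge0 m c A (u : m.-tuple RT) : 0 <= ball_weight c A u.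
Proof. by rewrite divr_ge0 ?exprn_ge0 ?sqrtr_ge0. Qed.

Lemma ball_weight_out m c A (u : m.-tuple RT) :
  A <= tuple_normsq u -> ball_weight c A u = 0.
Proof.
by move=> h; rewrite /ball_weight [X in _ / X]ler0_sqrtr ?invr0 ?mulr0// subr_le0.
Qed.

Lemma ball_fun_bound m beta c A (u : m.-tuple RT) :
  `|ball_fun beta c A u| <=
  Num.sqrt A ^+ (\sum_(i < m) beta i + c) * ball_weight 0 A u.
Proof.
have [h|h] := leP A (tuple_normsq u).
  by rewrite /ball_fun !ball_weight_out// !mulr0 normr0.
have t_le i : `|tnth u i| <= Num.sqrt A.
  rewrite -sqrtr_sqr ler_wsqrtr// (le_trans _ (ltW h))//.
  by rewrite /tuple_normsq (bigD1 i)//= lerDl sumr_ge0// => j _; exact: sqr_ge0.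
have w_le : Num.sqrt (A - tuple_normsq u) <= Num.sqrt A.
  by rewrite ler_wsqrtr// gerBl sumr_ge0// => j _; exact: sqr_ge0.
rewrite /ball_fun normrM [in X in _ * X](ger0_norm (ball_weight_ge0 _ _ _)).
rewrite exprD -mulrA ler_pM ?ball_weight_ge0//.
  rewrite normr_prod -prodrXr; apply: ler_prod => i _.
  by rewrite normr_ge0 normrX lerXn2r ?nnegrE ?sqrtr_ge0.
rewrite /ball_weight expr0 mul1r ler_wpM2r ?invr_ge0 ?sqrtr_ge0//.
by rewrite lerXn2r ?nnegrE ?sqrtr_ge0.
Qed.

Lemma ball_fun0 m A (u : m.-tuple RT) :
  ball_fun (fun=> 0%N) 0 A u = ball_weight 0 A u.
Proof. by rewrite /ball_fun big1 ?mul1r// => i _; rewrite expr0. Qed.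

(** Lebesgue measure on R ^ (m + 1) is the image of a product measure on
    R x R ^ m, so the theorems of Tonelli and Fubini apply. *)
Lemma integral_cons m (f : m.+1.-tuple RT -> R) :
  measurable_fun setT (f : _ -> RT) ->
  (\int[lebesgue_measure]_t \int[lebesgue_tuple m]_u `|(f (tuple_cons (t, u)))%:E|
     < +oo)%E ->
  (lebesgue_tuple m.+1).-integrable setT (EFin \o f) /\
  (\int[lebesgue_tuple m.+1]_v (f v)%:E =
   \int[lebesgue_measure]_t \int[lebesgue_tuple m]_u (f (tuple_cons (t, u)))%:E)%E.
Proof.
move=> mf foo.
have mg : measurable_fun setT ((EFin \o f) \o @tuple_cons R m).
  apply: measurableT_comp; last exact: measurable_tuple_cons.
  exact/measurable_EFinP.
have ig : (lebesgue_measure \x lebesgue_tuple m)%E.-integrable setT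
    ((EFin \o f) \o @tuple_cons R m).
  by apply/integrable12ltyP.
split.
  apply: (integrable_pushforward (@measurable_tuple_cons R m)) => //.
  exact/measurable_EFinP.
transitivity (\int[lebesgue_measure \x lebesgue_tuple m]_z (f (tuple_cons z))%:E)%E.
  apply: (integral_pushforward (@measurable_tuple_cons R m)) => //.
  exact/measurable_EFinP.
by rewrite -integral12_prod_meas1.
Qed.

(** Integrating the first coordinate t last, the remaining coordinates see the same
    problem with A replaced by A - t ^ 2; by induction they give a power of
    sqrt (A - t ^ 2), which [semicircle_moment] integrates against t ^ beta_0.
    Integrability on the product comes from the same computation for the
    nonnegative function [ball_fun (fun=> 0%N) 0], which dominates up to a
    constant factor. *)
Lemma ball_moment m beta c A :
  (lebesgue_tuple m).-integrable setT (EFin \o @ball_fun m beta c A) /\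
  (\int[lebesgue_tuple m]_u (ball_fun beta c A u)%:E =
   (ball_coef m beta c *
    (Num.sqrt A ^+ (\sum_(i < m) (beta i).+1 + c) / Num.sqrt A))%:E)%E.
Proof.
elim: m beta c A => [|m IH] beta c A.
  have ball0 (u : 0.-tuple RT) :
      ball_fun beta c A u = Num.sqrt A ^+ c / Num.sqrt A.
    by rewrite /ball_fun /ball_weight /tuple_normsq !big_ord0 subr0 mul1r.
  split.
    apply/integrableP; split; first exact: measurable_EFin_ball_fun.
    rewrite /= integral_dirac//; first by rewrite diracT mul1e ltry.
    apply/measurable_EFinP; apply: measurableT_comp; first exact: normr_measurable.
    exact: (@measurable_ball_fun 0%N beta c A).
  rewrite /= integral_dirac//; last exact: (@measurable_EFin_ball_fun 0%N beta c A).
  by rewrite diracT mul1e ball0 big_ord0 mul1r.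
pose s m := (\sum_(i < m) (beta i.+1).+1)%N.
have int_beta t := IH (fun i => beta i.+1) c (A - t ^+ 2).
have sE : (\sum_(i < m.+1) (beta i).+1 + c = (beta 0%N + (s m + c)).+1)%N.
  by rewrite big_ord_recl /s addSn addnA.
have bound : (\int[lebesgue_measure]_t \int[lebesgue_tuple m]_u
    `|(ball_fun beta c A (tuple_cons (t, u)))%:E| < +oo)%E.
  have [iw _] := semicircle_moment 0 m A.
  pose e := (\sum_(i < m) beta i.+1 + c)%N.
  have coef0 : 0 <= ball_coef m (fun=> 0%N) 0.
    have [_ E1] := IH (fun=> 0%N) 0%N 1.
    rewrite -lee_fin; move: E1; rewrite sqrtr1 expr1n divr1 mulr1 => <-.
    by apply: integral_ge0 => u _; rewrite lee_fin ball_fun0 ball_weight_ge0.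
  pose k := Num.sqrt A ^+ beta 0%N * Num.sqrt A ^+ e * ball_coef m (fun=> 0%N) 0.
  have k0 : 0 <= k by rewrite !mulr_ge0// exprn_ge0 ?sqrtr_ge0.
  apply: (@le_lt_trans _ _ (\int[lebesgue_measure]_t
      (k * (t ^+ 0 * semicircle_fun A m t))%:E)%E); last first.
    by apply: integrable_lty => //; exact: integrable_scale.
  apply: ge0_le_integral => //.
  + by move=> t _; exact: integral_ge0.
  + apply: (measurable_fun_fubini_tonelli_F
        (abse \o (EFin \o ball_fun beta c A) \o @tuple_cons R m)); last first.
      by move=> x; exact: abse_ge0.
    apply: measurableT_comp; last exact: measurable_tuple_cons.
    by apply: measurableT_comp => //; exact: measurable_EFin_ball_fun.
  + apply/measurable_EFinP; apply: measurable_funM => //.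
    apply: measurable_funM; first exact: measurable_funX.
    exact: measurable_semicircle_fun.
  move=> t _; have [At|At] := leP A (t ^+ 2).
    rewrite semicircle_fun0// !mulr0 integral0_eq// => u _.
    rewrite ball_fun_cons /ball_fun ball_weight_out ?mulr0 ?abse0//.
    by rewrite (@le_trans _ _ 0) ?subr_le0// sumr_ge0// => i _; exact: sqr_ge0.
  have [iw0 E0] := IH (fun=> 0%N) 0%N (A - t ^+ 2).
  apply: (@le_trans _ _ (\int[lebesgue_tuple m]_u
      ((Num.sqrt A ^+ beta 0%N * Num.sqrt A ^+ e)%:E *
        (ball_fun (fun=> 0%N) 0 (A - t ^+ 2) u)%:E))%E).
    apply: ge0_le_integral => //.
    + apply: measurableT_comp => //; apply/measurable_EFinP.
      apply: (measurableT_comp (@measurable_ball_fun m.+1 beta c A)).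
      apply: (measurableT_comp (@measurable_tuple_cons R m)).
      exact: measurable_pair1.
    + by apply: measurable_funeM; exact: measurable_EFin_ball_fun.
    + move=> u _; rewrite ball_fun_cons -EFinM lee_fin normrM -mulrA ler_pM//.
        rewrite normrX lerXn2r ?nnegrE ?sqrtr_ge0//.
        by rewrite -sqrtr_sqr ler_wsqrtr// ltW.
      rewrite ball_fun0; apply: le_trans (ball_fun_bound _ _ _ _) _.
      rewrite ler_wpM2r ?ball_weight_ge0// lerXn2r ?nnegrE ?sqrtr_ge0//.
      by rewrite ler_wsqrtr// gerBl sqr_ge0.
  rewrite integralZl// E0 -EFinM lee_fin /k -!mulrA !ler_wpM2l ?exprn_ge0 ?sqrtr_ge0//.
  by rewrite expr0 mul1r sum_nat_const card_ord muln1 addn0.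
have [ifun ->] := integral_cons (@measurable_ball_fun m.+1 beta c A) bound.
split=> //.
have [isc sc] := semicircle_moment (beta 0%N) (s m + c) A.
under eq_integral => t _.
  under eq_integral => u _ do rewrite ball_fun_cons EFinM.
  have [ib Eb] := int_beta t.
  rewrite integralZl// Eb -EFinM mulrCA.
  over.
under eq_integral => t _ do rewrite EFinM.
rewrite integralZl//.
rewrite -[X in (_ * X)%E]fineK; last by apply: integrable_fin_num.
rewrite -EFinM; congr EFin.
move: sc; rewrite /Rintegral sE /= => ->.
by rewrite mulrA.
Qed.

End ball_moments.
(** * Recurrences of the moments *)

Section ball_coef_theory.
Context {R : realType}.
Implicit Types (m c : nat) (beta : nat -> nat).

Local Notation weight m beta := (\sum_(i < m) (beta i).+1)%N.

Lemma eq_ball_coef m beta1 beta2 c : (forall i, (i < m)%N -> beta1 i = beta2 i) ->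
  ball_coef m beta1 c = ball_coef m beta2 c :> R.
Proof.
elim: m beta1 beta2 => //= m IH beta1 beta2 E.
rewrite (IH _ (fun i => beta2 i.+1)); last by move=> i im; exact: E.
by rewrite E// (eq_bigr (fun i : 'I_m => (beta2 i.+1).+1))// => i _; rewrite E// ltnS.
Qed.

(** The recurrences [wallis_cos2] of the factors telescope: the factor gained at one
    coordinate is the one lost at the next. *)
Lemma ball_coef_height m beta c :
  (weight m beta + c).+1%:R * ball_coef m beta c.+2 =
  c.+1%:R * ball_coef m beta c :> R.
Proof.
elim: m beta c => [|m IH] beta c; first by rewrite big_ord0.
rewrite big_ord_recl /= !addnS.
have := IH (fun i => beta i.+1) c.
set s := (\sum_(i < m) (beta i.+1).+1)%N => E.
have -> : ((beta 0).+1 + s + c).+1%N = (beta 0 + (s + c) + 2)%N by lia.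
by rewrite mulrCA wallis_cos2 [LHS]mulrCA [LHS]mulrA E [RHS]mulrA.
Qed.

(** Raising beta j by 2 shifts by 2 the second parameter of the Wallis integrals of
    the coordinates before j, and their recurrences telescope as in
    [ball_coef_height]. *)
Lemma ball_coef_shift m beta c j : (j < m)%N ->
  (weight m beta + c).+1%:R *
    ball_coef m (fun i => if i == j then (beta i).+2 else beta i) c =
  (beta j).+1%:R * ball_coef m beta c :> R.
Proof.
elim: m beta j => // m IH beta [|j] jm; rewrite big_ord_recl /=.
  set s := (\sum_(i < m) _)%N.
  have -> : ((beta 0).+1 + s + c).+1%N = (beta 0 + (s + c) + 2)%N by lia.
  by rewrite mulrCA wallis_sin2 mulrCA.
have /= := IH (fun i => beta i.+1) j jm.
set s := (\sum_(i < m) (beta i.+1).+1)%N => E.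
have -> : (\sum_(i < m) (if i.+1 == j.+1 then (beta i.+1).+2 else beta i.+1).+1 = s.+2)%N.
  have jm' : (j < m)%N by [].
  rewrite /s (bigD1 (Ordinal jm'))//= eqxx [in RHS](bigD1 (Ordinal jm'))//= -!addSn.
  by congr (_ + _)%N; apply: eq_bigr => i; rewrite -val_eqE /= eqSS => /negbTE ->.
rewrite addSn addSn.
have -> : ((beta 0).+1 + s + c).+1%N = (beta 0 + (s + c) + 2)%N by lia.
by rewrite mulrCA wallis_cos2 [LHS]mulrCA [LHS]mulrA E [RHS]mulrA.
Qed.

Lemma ball_coef_odd m beta c j : (j < m)%N -> beta j = 1%N ->
  ball_coef m beta c = 0 :> R.
Proof.
elim: m beta j => // m IH beta [|j] jm b1 /=; first by rewrite b1 wallis1 mulr0.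
by rewrite (IH _ j) ?mul0r.
Qed.

End ball_coef_theory.
(** * The surface integral as a functional on polynomials *)

Section sphere_as_graphs.
Context {R : realType} {m : nat}.
Local Notation RT := (measurableTypeR R).
Variable r : R.
Hypothesis r0 : 0 < r.

Lemma eucl_norm_sqr n (x : 'rV[R]_n) : eucl_norm x ^+ 2 = \sum_(i < n) x 0 i ^+ 2.
Proof. by rewrite sqr_sqrtr// sumr_ge0// => i _; exact: sqr_ge0. Qed.

Lemma eucl_norm_ge0 n (x : 'rV[R]_n) : 0 <= eucl_norm x.
Proof. exact: sqrtr_ge0. Qed.

Lemma eucl_norm_row_of_tuple (u : m.-tuple RT) :
  eucl_norm (row_of_tuple u) ^+ 2 = tuple_normsq u.
Proof. by rewrite eucl_norm_sqr; apply: eq_bigr => i _; rewrite mxE. Qed.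

(** The sign e = 1 or e = -1 treats both hemispheres at once.  On the line through
    v in the direction i, the function is t |-> e * sqrt (A - 2 v_i t - t ^ 2). *)
Lemma derive_hemisphere (e : R) (v : 'rV[R]_m) i : eucl_norm v < r ->
  'D_(delta_mx 0 i) (fun u => e * hemisphere r u) v = - e * v 0 i / hemisphere r v.
Proof.
move=> vr; set A := r ^+ 2 - eucl_norm v ^+ 2.
have A0 : 0 < A by rewrite subr_gt0 ltrXn2r// ?nnegrE ?eucl_norm_ge0// ltW.
pose phi (t : R) := e * Num.sqrt (A - 2 * v 0 i * t - t ^+ 2).
have phiE t : e * hemisphere r (t *: delta_mx 0 i + v) = phi t.
  rewrite /phi /hemisphere /A !eucl_norm_sqr; congr (e * Num.sqrt _).
  rewrite -!addrA; congr (_ + _); rewrite (bigD1 i)//= [in RHS](bigD1 i)//=.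
  rewrite !mxE !eqxx mulr1 (eq_bigr (fun j => v 0 j ^+ 2)); first by ring.
  by move=> j ji; rewrite !mxE eqxx (negbTE ji) mulr0 add0r.
have dphi : is_derive (0 : R) 1 phi (- e * v 0 i / Num.sqrt A).
  pose a (t : R) := A - 2 * v 0 i * t - t ^+ 2.
  have a0 : a 0 = A by rewrite /a mulr0 expr0n !subr0.
  have da : is_derive (0 : R) 1 a (- 2 * v 0 i).
    have -> : a = (fun t => (A%:P - (2 * v 0 i) *: 'X - 'X^2 : {poly R}).[t]).
      by apply/funext => t; rewrite !hornerE.
    apply: is_derive_eq; rewrite !derivB derivC derivZ derivX derivXn !hornerE /=.
    by ring.
  have a0' : 0 < a 0 by rewrite a0.
  have ds := is_derive1_sqrt a0'.
  have -> : phi = e *: (Num.sqrt \o a) by apply/funext.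
  apply: is_derive_eq; rewrite a0 -[_ *: (_ : R^o)]/(_ * _).
  have sA : Num.sqrt A != 0 by rewrite gt_eqF// sqrtr_gt0.
  by field.
have <- : 'D_1 phi 0 = - e * v 0 i / Num.sqrt A by case: dphi.
pose f (u : 'rV[R]_m) := e * hemisphere r u.
have E : (fun t : R => t^-1 *: ((f \o shift v) (t *: delta_mx 0 i) - f v)) =
    (fun t : R => t^-1 *: ((phi \o shift 0) (t *: (1 : R)) - phi 0)).
  apply/funext => t; rewrite /= [_ *: 1]mulr1 addr0.
  by rewrite /f phiE -(phiE 0) scale0r add0r.
exact: (congr1 (fun g : R -> R => lim (g @ 0^')) E).
Qed.

Lemma graph_area_hemisphere (e : R) (v : 'rV[R]_m) : e ^+ 2 = 1 ->
  eucl_norm v < r ->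
  graph_area_element (fun u => e * hemisphere r u) v = r / hemisphere r v.
Proof.
move=> e2 vr; have A0 : 0 < r ^+ 2 - eucl_norm v ^+ 2.
  by rewrite subr_gt0 ltrXn2r// ?nnegrE ?eucl_norm_ge0// ltW.
have h0 : 0 < hemisphere r v by rewrite sqrtr_gt0.
have hh : hemisphere r v ^+ 2 = r ^+ 2 - eucl_norm v ^+ 2 by rewrite sqr_sqrtr// ltW.
rewrite /graph_area_element; under eq_bigr do rewrite derive_hemisphere//.
rewrite (_ : 1 + _ = (r / hemisphere r v) ^+ 2).
  by rewrite sqrtr_sqr ger0_norm// divr_ge0// ltW.
rewrite expr_div_n; under eq_bigr do rewrite expr_div_n exprMn sqrrN e2 mul1r.
rewrite -mulr_suml -eucl_norm_sqr hh -{1}(divff (lt0r_neq0 A0)) -mulrDl.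
by rewrite subrK.
Qed.

Definition sphere_point (e : R) (u : m.-tuple RT) : 'rV[R]_m.+1 :=
  @graph_point R m.+1 u (e * Num.sqrt (r ^+ 2 - tuple_normsq u)).

(** The area element r / sqrt (r ^ 2 - |u| ^ 2) of the sphere, extended by 0 outside
    the ball |u| < r. *)
Definition hemisphere_weight (u : m.-tuple RT) : R := r * ball_weight 0 (r ^+ 2) u.

Definition hemisphere_integral (e : R) (g : 'rV[R]_m.+1 -> R) : R :=
  \int[lebesgue_tuple m]_u (g (sphere_point e u) * hemisphere_weight u).

Lemma graph_integral_hemisphere (e : R) (g : 'rV[R]_m.+1 -> R) : e ^+ 2 = 1 ->
  @graph_integral R m.+1 (eucl_ball r) (fun u => e * hemisphere r u) g =
  hemisphere_integral e g.
Proof.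
move=> e2; rewrite /graph_integral Rintegral_mkcond; apply: eq_Rintegral => u _.
rewrite patchE /hemisphere_weight /ball_weight expr0 mul1r.
case: ifPn => [|]; rewrite ?notin_setE ?inE /preimage /eucl_ball /=.
  move=> ur; rewrite graph_area_hemisphere// /sphere_point /hemisphere.
  by rewrite eucl_norm_row_of_tuple.
move=> /negP; rewrite -leNgt => ur.
rewrite [X in _ / X]ler0_sqrtr ?invr0 ?mulr0// subr_le0.
by rewrite -eucl_norm_row_of_tuple lerXn2r// nnegrE ?eucl_norm_ge0// ltW.
Qed.

Lemma sphere_integralE (g : 'rV[R]_m.+1 -> R) :
  sphere_integral r g = hemisphere_integral 1 g + hemisphere_integral (-1) g.
Proof.
have e1 : (1 : R) ^+ 2 = 1 by rewrite expr1n.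
have e2 : (-1 : R) ^+ 2 = 1 by rewrite sqrrN expr1n.
rewrite -(graph_integral_hemisphere g e1) -(graph_integral_hemisphere g e2).
rewrite (_ : (fun u : 'rV[R]_m => 1 * _) = hemisphere r); last first.
  by apply/funext => u; rewrite mul1r.
rewrite (_ : (fun u : 'rV[R]_m => -1 * _) = (fun u => - hemisphere r u)); last first.
  by apply/funext => u; rewrite mulN1r.
by [].
Qed.

Lemma sphere_point_lt (e : R) u (i : 'I_m) :
  sphere_point e u 0 (widen_ord (leqnSn m) i) = tnth u i.
Proof. by rewrite mxE /= -tnth_nth. Qed.

Lemma sphere_point_max (e : R) u :
  sphere_point e u 0 ord_max = e * Num.sqrt (r ^+ 2 - tuple_normsq u).
Proof. by rewrite mxE nth_default// size_tuple. Qed.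

Lemma sphere_point_normsq (e : R) u : e ^+ 2 = 1 -> tuple_normsq u < r ^+ 2 ->
  \sum_i sphere_point e u 0 i ^+ 2 = r ^+ 2.
Proof.
move=> e2 ur; rewrite big_ord_recr /= sphere_point_max exprMn e2 mul1r.
under eq_bigr do rewrite sphere_point_lt.
by rewrite sqr_sqrtr ?subr_ge0 ?(ltW ur)// addrC subrK.
Qed.

Lemma measurable_sphere_point (e : R) i :
  measurable_fun setT (fun u => sphere_point e u 0 i : RT).
Proof.
have [j ->|->] := unliftP ord_max i.
  have -> : lift ord_max j = widen_ord (leqnSn m) j by apply: ord_inj; exact: lift_max.
  by under eq_fun do rewrite sphere_point_lt; exact: measurable_tnth.
under eq_fun do rewrite sphere_point_max.
apply: measurable_funM => //; apply: measurableT_comp; first exact: measurable_sqrt.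
by apply: measurable_funB => //; exact: measurable_tuple_normsq.
Qed.

Lemma measurable_poly_sphere_point (e : R) (p : mpoly m.+1 R) :
  measurable_fun setT (fun u => poly_fun p (sphere_point e u) : RT).
Proof.
rewrite /poly_fun; under eq_fun do rewrite mevalE.
apply: measurable_sum => a; apply: measurable_funM => //.
apply: measurable_prod => i _; apply: measurable_funX.
exact: measurable_sphere_point.
Qed.

Lemma measurable_hemisphere_weight : measurable_fun setT (hemisphere_weight : _ -> RT).
Proof. by apply: measurable_funM => //; exact: measurable_ball_weight. Qed.

Lemma hemisphere_weight_ge0 u : 0 <= hemisphere_weight u.
Proof. by rewrite mulr_ge0 ?ball_weight_ge0// ltW. Qed.

Definition height_last (a : multinom m.+1) : nat := a ord_max.
Definition base_exponents (a : multinom m.+1) : nat -> nat := fun i => a (inord i).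

Lemma base_exponentsE a (i : 'I_m) : base_exponents a i = a (widen_ord (leqnSn m) i).
Proof.
rewrite /base_exponents; congr (a _).
by apply: ord_inj; rewrite inordK// ltnW// ltnS.
Qed.

Lemma mdeg_recr a :
  (\sum_(i < m) (base_exponents a i).+1 + height_last a = mdeg a + m)%N.
Proof.
rewrite mdegE big_ord_recr /= -/(height_last a) addnAC; congr (_ + _)%N.
under eq_bigr do rewrite -addn1.
rewrite big_split /= sum_nat_const card_ord muln1; congr (_ + _)%N.
by apply: eq_bigr => i _; rewrite base_exponentsE.
Qed.

Lemma hemisphere_monomial (e : R) a u :
  poly_fun (mpolyX R a) (sphere_point e u) * hemisphere_weight u =
  e ^+ height_last a * r *
    ball_fun (base_exponents a) (height_last a) (r ^+ 2) u.
Proof.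
rewrite /poly_fun mevalX big_ord_recr /= sphere_point_max exprMn.
rewrite /ball_fun /hemisphere_weight /ball_weight expr0 mul1r.
under eq_bigr do rewrite sphere_point_lt -base_exponentsE.
rewrite /height_last; ring.
Qed.

Lemma hemisphere_moment (e : R) a :
  (lebesgue_tuple m).-integrable setT
    (EFin \o (fun u => poly_fun (mpolyX R a) (sphere_point e u) * hemisphere_weight u)) /\
  hemisphere_integral e (poly_fun (mpolyX R a)) =
    e ^+ height_last a * ball_coef m (base_exponents a) (height_last a) *
      r ^+ (mdeg a + m).
Proof.
have [ib Eb] := ball_moment m (base_exponents a) (height_last a) (r ^+ 2).
split.
  rewrite (_ : _ \o _ = EFin \o (fun u => e ^+ height_last a * r *
     ball_fun (base_exponents a) (height_last a) (r ^+ 2) u)).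
    exact: integrable_scale.
  by apply/funext => u; rewrite /= hemisphere_monomial.
rewrite /hemisphere_integral; under eq_Rintegral do rewrite hemisphere_monomial.
rewrite RintegralZl// /Rintegral Eb /= mdeg_recr sqrtr_sqr gtr0_norm//.
by field; rewrite gt_eqF.
Qed.

Lemma integrable_hemisphere_poly (e : R) (p : mpoly m.+1 R) :
  (lebesgue_tuple m).-integrable setT
    (EFin \o (fun u => poly_fun p (sphere_point e u) * hemisphere_weight u)).
Proof.
elim/mpolyind: p => [|c a p _ _ IH].
  rewrite (_ : _ \o _ = cst 0%E); first exact: integrable0.
  by apply/funext => u; rewrite /= /poly_fun meval0 mul0r.
have [ia _] := hemisphere_moment e a.
rewrite (_ : _ \o _ = (fun u => c%:E *
    (poly_fun (mpolyX R a) (sphere_point e u) * hemisphere_weight u)%:E) \+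
    (EFin \o (fun u => (poly_fun p (sphere_point e u) * hemisphere_weight u)%R)))%E.
  by apply: integrableD => //; exact: integrableZl.
apply/funext => u; rewrite /= -EFinM -EFinD; congr EFin.
by rewrite /poly_fun mevalD mevalZ; ring.
Qed.

Lemma hemisphere_integral_linear (e c : R) (p q : mpoly m.+1 R) :
  hemisphere_integral e (poly_fun (c *: p + q)) =
  c * hemisphere_integral e (poly_fun p) + hemisphere_integral e (poly_fun q).
Proof.
have ip := integrable_hemisphere_poly e p; have iq := integrable_hemisphere_poly e q.
rewrite /hemisphere_integral -RintegralZl// -RintegralD//.
  by apply: eq_Rintegral => u _; rewrite /poly_fun mevalD mevalZ; ring.
exact: integrable_scale.
Qed.

Definition sphere_functional (p : mpoly m.+1 R) : R := sphere_integral r (poly_fun p).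

Lemma sphere_functional_linear (c : R) p q :
  sphere_functional (c *: p + q) = c * sphere_functional p + sphere_functional q.
Proof.
by rewrite /sphere_functional !sphere_integralE !hemisphere_integral_linear; ring.
Qed.

Lemma sphere_moment a : sphere_functional (mpolyX R a) =
  (1 + (-1) ^+ height_last a) *
    ball_coef m (base_exponents a) (height_last a) * r ^+ (mdeg a + m).
Proof.
rewrite /sphere_functional sphere_integralE.
rewrite (hemisphere_moment 1 a).2 (hemisphere_moment (-1) a).2 expr1n; ring.
Qed.

(** With a = g + e_i, both sides are moments for exponents that differ from g by 0
    or by 2 e_i: they are related by [ball_coef_shift] when i is a coordinate of
    the base of the graph, by [ball_coef_height] when it is the height.  When
    a_i = 0 the left-hand side is 0, and the moment on the right is odd in the
    coordinate i. *)
Lemma sphere_divergence_monomial i a :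
  r ^+ 2 * sphere_functional (mderiv i (mpolyX R a)) =
  (mdeg a + m)%:R * sphere_functional (mpolyX R (mnm1 i) * mpolyX R a).
Proof.
rewrite mderivX (functionalZ sphere_functional_linear) -mpolyXD !sphere_moment.
have degD : mdeg (mnm_add (mnm1 i) a) = (mdeg a).+1 by rewrite mdegD mdeg1.
have [ai0|ai] := eqVneq (a i) 0%N.
  rewrite ai0 mul0r mulr0.
  have [j ij|imax] := unliftP ord_max i.
    rewrite (@ball_coef_odd _ _ _ _ j) ?ltn_ord ?mulr0 ?mul0r ?mulr0//.
    have ji : widen_ord (leqnSn m) j = i by rewrite ij; apply: ord_inj; rewrite lift_max.
    by rewrite base_exponentsE ji mnmDE mnm1E eqxx ai0.
  by rewrite /height_last mnmDE mnm1E imax eqxx -imax ai0 expr1 subrr !mul0r mulr0.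
pose g := mnm_sub a (mnm1 i).
have ag : a = mnm_add g (mnm1 i).
  by rewrite mnm_subK1.
have agi : a i = (g i).+1 by rewrite ag mnmDE mnm1E eqxx addn1.
have adeg : mdeg a = (mdeg g).+1 by rewrite ag mdegD mdeg1 addn1.
rewrite -/g agi degD adeg.
have hg k : mnm_add (mnm1 i) a k = if k == i then (g k).+2 else g k.
  by rewrite ag !mnmDE !mnm1E eq_sym; case: eqP => [->|]; lia.
have mg := mdeg_recr g.
have [j ij|imax] := unliftP ord_max i.
  have ji : widen_ord (leqnSn m) j = i by rewrite ij; apply: ord_inj; rewrite lift_max.
  have hl : height_last (mnm_add (mnm1 i) a) = height_last g.
    by rewrite /height_last hg ifN// ij eq_liftF.
  have E := ball_coef_shift (base_exponents g) (height_last g) (ltn_ord j) (R := R).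
  rewrite hl (@eq_ball_coef _ _ (base_exponents (mnm_add (mnm1 i) a))
     (fun k => if k == j then (base_exponents g k).+2
               else base_exponents g k)); last first.
    move=> k km; rewrite -[k]/(nat_of_ord (Ordinal km)) !base_exponentsE hg -ji.
    by rewrite -(inj_eq val_inj).
  have -> : (g i).+1%:R = (base_exponents g j).+1%:R :> R by rewrite base_exponentsE ji.
  rewrite mg -addSn in E.
  rewrite [X in X = _](_ : _ = ((base_exponents g j).+1%:R *
     ball_coef m (base_exponents g) (height_last g)) *
     ((1 + (-1) ^+ height_last g) * r ^+ ((mdeg g).+2 + m))).
    by rewrite -E; ring.
  by rewrite !addSn !exprS; ring.
have hl : height_last (mnm_add (mnm1 i) a) = (height_last g).+2.
  by rewrite /height_last hg imax eqxx.
have E := ball_coef_height m (base_exponents g) (height_last g) (R := R).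
rewrite hl (@eq_ball_coef _ _ (base_exponents (mnm_add (mnm1 i) a))
  (base_exponents g)); last first.
  move=> k km; rewrite -[k]/(nat_of_ord (Ordinal km)) !base_exponentsE hg imax ifN//.
  by rewrite -(inj_eq val_inj) /= ltn_eqF.
have -> : (g i).+1%:R = (height_last g).+1%:R :> R by rewrite imax.
rewrite mg -addSn in E.
rewrite [X in X = _](_ : _ = ((height_last g).+1%:R *
   ball_coef m (base_exponents g) (height_last g)) *
   ((1 + (-1) ^+ height_last g) * r ^+ ((mdeg g).+2 + m))).
  by rewrite -E exprS exprS; ring.
by rewrite !addSn !exprS; ring.
Qed.

(** This is the tangential divergence theorem on the sphere for a homogeneous
    polynomial times a coordinate vector field, in which Euler's identity has
    replaced the normal derivative of p. *)
Lemma sphere_divergence i d p : p \is ishomog1 d (@mdeg m.+1) ->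
  r ^+ 2 * sphere_functional (mderiv i p) =
  (d + m)%:R * sphere_functional (mpolyX R (mnm1 i) * p).
Proof.
move=> /dhomogP hp; rewrite [p]mpolyE linear_sum mulr_sumr.
rewrite !(functional_sum sphere_functional_linear) !mulr_sumr big_seq [RHS]big_seq.
apply: eq_bigr => a /hp /= da; rewrite linearZ /= -scalerAr.
rewrite !(functionalZ sphere_functional_linear) mulrCA sphere_divergence_monomial da.
by rewrite mulrCA.
Qed.

End sphere_as_graphs.
(** * Expansion of the Newtonian kernel *)

Section newton_kernel.
Context {R : realType} {n : nat}.
Variable r : R.
Hypothesis r0 : 0 < r.
Hypothesis n3 : (3 <= n)%N.

Lemma cauchy_schwarz (x y : 'rV[R]_n) :
  (\sum_i x 0 i * y 0 i) ^+ 2 <= (\sum_i x 0 i ^+ 2) * (\sum_i y 0 i ^+ 2).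
Proof.
set p := \sum_i _; set N := \sum_i _; set q := \sum_i y 0 i ^+ 2.
have q_ge0 : 0 <= q by rewrite sumr_ge0// => i _; exact: sqr_ge0.
have E : \sum_i (q * x 0 i - p * y 0 i) ^+ 2 = q * (N * q - p ^+ 2).
  transitivity (\sum_i (q ^+ 2 * x 0 i ^+ 2 - 2 * q * p * (x 0 i * y 0 i)
      + p ^+ 2 * y 0 i ^+ 2)); first by apply: eq_bigr => i _; ring.
  rewrite big_split /= sumrB -!mulr_sumr -/N -/p -/q; ring.
have [q0|q0] := eqVneq q 0.
  have y0 i : y 0 i = 0.
    have := q0; rewrite /q => /psumr_eq0P => h.
    by apply/eqP; rewrite -sqrf_eq0 h// => j _; exact: sqr_ge0.
  by rewrite /p big1 ?expr0n ?q0 ?mulr0// => i _; rewrite y0 mulr0.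
have q_gt0 : 0 < q by rewrite lt_def q0.
rewrite -subr_ge0 -(pmulr_rge0 _ q_gt0) -E sumr_ge0// => i _; exact: sqr_ge0.
Qed.

(** The partial sum of the expansion of r ^ (n - 2) / |x - y| ^ (n - 2), as a
    polynomial in y. *)
Definition kernel_poly (M : nat) (x : 'rV[R]_n) : mpoly n R :=
  \sum_(k < M.+1) (kappa (n - 2) k / r ^+ (2 * k)) *: zonal x k.

(** [kernel_expansion] for b = x . y / r ^ 2 and a = |x| ^ 2 / r ^ 2, for which
    |x - y| ^ 2 = r ^ 2 * (1 - 2 b + a). *)
Lemma kernel_poly_error M (x y : 'rV[R]_n) : eucl_norm x < r ->
  \sum_i y 0 i ^+ 2 = r ^+ 2 ->
  `|meval (y 0) (kernel_poly M x) - r ^+ (n - 2) / eucl_norm (x - y) ^+ (n - 2)|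
    <= kernel_error (n - 2) (eucl_norm x / r) M.
Proof.
move=> xr yr.
have r0' : r != 0 by rewrite gt_eqF.
pose p := \sum_i x 0 i * y 0 i.
pose b := p / r ^+ 2.
pose a := (eucl_norm x / r) ^+ 2.
pose z k := meval (y 0) (zonal x k) / r ^+ (2 * k).
have rx : 0 <= eucl_norm x / r by rewrite divr_ge0 ?eucl_norm_ge0// ltW.
have aE : a = (\sum_i x 0 i ^+ 2) / r ^+ 2 by rewrite /a expr_div_n eucl_norm_sqr.
have meval_dot : meval (y 0) (dot_poly x) = p.
  by rewrite /dot_poly raddf_sum /=; apply: eq_bigr => i _; rewrite mevalZ mevalXU.
have meval_nsq : meval (y 0) (@normsq_poly R n) = r ^+ 2.
  rewrite /normsq_poly raddf_sum /= -yr; apply: eq_bigr => i _.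
  by rewrite !expr2 mevalM mevalXU.
have z0 : z 0%N = 1 by rewrite /z /= meval1 muln0 expr0 divr1.
have z1 : z 1%N = b by rewrite /z /= meval_dot muln1.
have zS k : (k.+1 + (n - 2))%:R * z k.+2 =
    (k.+1.*2 + (n - 2))%:R * b * z k.+1 - k.+1%:R * a * z k.
  rewrite /z mulrA -mevalZ zonal_rec mevalB !mevalZ !mevalM meval_dot meval_nsq.
  rewrite /b aE (_ : 2 * k.+2 = 2 * k + 4)%N; last by lia.
  rewrite (_ : 2 * k.+1 = 2 * k + 2)%N; last by lia.
  rewrite !exprD; field.
  by rewrite expf_neq0 ?r0'.
have ba : b ^+ 2 <= a.
  rewrite /b aE expr_div_n -exprM ler_pdivrMr ?exprn_gt0//.
  rewrite (_ : 2 * 2 = 2 + 2)%N// exprD mulrA divfK ?expf_neq0//.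
  by rewrite -yr cauchy_schwarz.
have d0 : (0 < n - 2)%N by lia.
have := kernel_expansion d0 ba z0 z1 zS M rx _ (erefl _).
rewrite ltr_pdivrMr// mul1r => /(_ xr).
congr (`|_ - _| <= _).
- rewrite /kernel_poly raddf_sum /=; apply: eq_bigr => k _.
  by rewrite mevalZ /z mulrAC mulrA.
- have -> : eucl_norm (x - y) = r * Num.sqrt (1 - 2 * b + a).
    rewrite -[r in RHS]gtr0_norm// -sqrtr_sqr -sqrtrM ?sqr_ge0//; congr Num.sqrt.
    rewrite /b aE -[in LHS]/(eucl_norm _).
    transitivity (\sum_i (x 0 i ^+ 2 - 2 * (x 0 i * y 0 i) + y 0 i ^+ 2)).
      by apply: eq_bigr => i _; rewrite !mxE; ring.
    rewrite big_split /= sumrB -mulr_sumr yr -/p; field.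
    by rewrite r0'.
  by rewrite exprMn invfM mulVKf// expf_neq0.
Qed.

End newton_kernel.

(** * The potential is a polynomial *)

Section potential.
Context {R : realType} {m : nat}.
Local Notation RT := (measurableTypeR R).
Variable r : R.
Hypothesis r0 : 0 < r.
Hypothesis n3 : (3 <= m.+1)%N.
Variables (f : mpoly m.+1 R) (x : 'rV[R]_m.+1).
Hypothesis xr : eucl_norm x < r.

Let d := (m.+1 - 2)%N.

Definition newton_kernel (y : 'rV[R]_m.+1) : R := r ^+ d / eucl_norm (x - y) ^+ d.

Lemma measurable_newton_kernel (e : R) :
  measurable_fun setT (fun u : m.-tuple RT => newton_kernel (sphere_point r e u) : RT).
Proof.
apply: measurable_funM => //; apply: measurableT_comp; first exact: measurable_inv.
apply: measurable_funX; apply: measurableT_comp; first exact: measurable_sqrt.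
apply: measurable_sum => i; apply: measurable_funX.
rewrite (_ : (fun u => _) = (fun u => x 0 i - sphere_point r e u 0 i)).
  by apply: measurable_funB => //; exact: measurable_sphere_point.
by apply/funext => u; rewrite !mxE.
Qed.

Let err M := kernel_error d (eucl_norm x / r) M.

Lemma newton_kernel_error (e : R) M (u : m.-tuple RT) : e ^+ 2 = 1 ->
  `|(poly_fun (kernel_poly r M x) (sphere_point r e u) -
     newton_kernel (sphere_point r e u)) *
    (poly_fun f (sphere_point r e u) * hemisphere_weight r u)|
  <= err M * `|poly_fun f (sphere_point r e u) * hemisphere_weight r u|.
Proof.
move=> e2; rewrite normrM.
have [ur|ur] := ltP (tuple_normsq u) (r ^+ 2).
  by rewrite ler_wpM2r// kernel_poly_error// sphere_point_normsq.
by rewrite /hemisphere_weight ball_weight_out// !mulr0 normr0 !mulr0.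
Qed.

(** On the sphere the kernel is within a constant of the first partial sum, which is
    constant in y. *)
Lemma integrable_newton_kernel (e : R) : e ^+ 2 = 1 ->
  (lebesgue_tuple m).-integrable setT (EFin \o (fun u =>
    newton_kernel (sphere_point r e u) * poly_fun f (sphere_point r e u) *
      hemisphere_weight r u)).
Proof.
move=> e2.
pose w u := poly_fun f (sphere_point r e u) * hemisphere_weight r u.
pose w0 u :=
  poly_fun (kernel_poly r 0 x * f) (sphere_point r e u) * hemisphere_weight r u.
apply: (@integrable_dominated R _ _ _ _ (fun u => `|w0 u| + err 0 * `|w u|)).
- apply: measurable_funM; last exact: measurable_hemisphere_weight.
  apply: measurable_funM; first exact: measurable_newton_kernel.
  exact: measurable_poly_sphere_point.
- move=> u; have := newton_kernel_error 0 u e2; rewrite -/(w u) => h.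
  have -> : newton_kernel (sphere_point r e u) * poly_fun f (sphere_point r e u) *
      hemisphere_weight r u = w0 u -
      (poly_fun (kernel_poly r 0 x) (sphere_point r e u) -
        newton_kernel (sphere_point r e u)) * w u.
    by rewrite /w0 /w /poly_fun mevalM; ring.
  by rewrite (le_trans (ler_normB _ _))// lerD2l.
- have iw : (lebesgue_tuple m).-integrable setT (EFin \o (Num.norm \o w)).
    by apply: integrable_norm; exact: integrable_hemisphere_poly.
  have iw0 : (lebesgue_tuple m).-integrable setT (EFin \o (Num.norm \o w0)).
    by apply: integrable_norm; exact: integrable_hemisphere_poly.
  rewrite (_ : _ \o _ = ((EFin \o (Num.norm \o w0)) \+
      (fun u => (err 0)%:E * (EFin \o (Num.norm \o w)) u))%E).
    by apply: integrableD => //; exact: integrableZl.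
  by apply/funext => u; rewrite /= -EFinM -EFinD.
Qed.

Lemma hemisphere_integral_error (e : R) M : e ^+ 2 = 1 ->
  `|hemisphere_integral r e (poly_fun (kernel_poly r M x * f)) -
    hemisphere_integral r e (fun y => newton_kernel y * poly_fun f y)|
  <= err M * hemisphere_integral r e (fun y => `|poly_fun f y|).
Proof.
move=> e2.
have ip := integrable_hemisphere_poly r0 e (kernel_poly r M x * f).
have ik := integrable_newton_kernel e2.
have iw : (lebesgue_tuple m).-integrable setT (EFin \o (fun u =>
    `|poly_fun f (sphere_point r e u)| * hemisphere_weight r u)).
  have := integrable_norm (integrable_hemisphere_poly r0 e f).
  apply: eq_integrable => // u _ /=.
  by rewrite normrM [X in (_ * X)%:E]ger0_norm// hemisphere_weight_ge0.
rewrite /hemisphere_integral -RintegralB// -RintegralZl//.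
apply: (le_trans (le_normr_Rintegral _ _)) => //.
  exact: (integrableB _ ip ik).
apply: le_Rintegral => //.
- exact: (integrable_norm (integrableB _ ip ik)).
- exact: integrable_scale.
- move=> u _; have := newton_kernel_error M u e2.
  rewrite [X in _ <= _ * X]normrM (ger0_norm (hemisphere_weight_ge0 r0 u)).
  by congr (`|_| <= _); rewrite /poly_fun mevalM; ring.
Qed.

End potential.

Section sphere_potential.
Context {R : realType} {m : nat}.
Variable r : R.
Hypothesis r0 : 0 < r.
Hypothesis n3 : (3 <= m.+1)%N.
Variables (k : nat) (f : mpoly m.+1 R).
Hypothesis fk : degree_at_most k f.
Local Notation L := (@sphere_functional R m r).
Let L_linear := @sphere_functional_linear R m r r0.
Let L_div := @sphere_divergence R m r r0.

Lemma kernel_poly_stationary M x : (k <= M)%N ->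
  L (kernel_poly r M x * f) = L (kernel_poly r k x * f).
Proof.
move=> kM; rewrite /kernel_poly !mulr_suml !(functional_sum L_linear).
pose term j := L (((kappa (m.+1 - 2) j / r ^+ (2 * j)) *: zonal x j) * f).
rewrite -!(big_mkord xpredT term).
rewrite (big_cat_nat _ (n := k.+1))//= [X in _ + X]big_nat [X in _ + X]big1 ?addr0//.
move=> j /andP[kj _]; rewrite /term -scalerAl (functionalZ L_linear).
by rewrite (orthogonal_zonal n3 L_linear L_div x fk) ?mulr0.
Qed.

(** The distance between the two sides is at most a multiple of every
    [kernel_error] of index at least k: beyond k, the integral against f of the
    partial sums of the expansion no longer changes. *)
Lemma newton_potentialE x : eucl_norm x < r ->
  sphere_integral r (fun y => newton_kernel r x y * poly_fun f y) =
  L (kernel_poly r k x * f).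
Proof.
move=> xr; pose G y := newton_kernel r x y * poly_fun f y.
pose C := hemisphere_integral r 1 (fun y => `|poly_fun f y|) +
          hemisphere_integral r (-1) (fun y => `|poly_fun f y|).
pose A := eucl_norm x / r.
have A0 : 0 <= A by rewrite divr_ge0 ?eucl_norm_ge0// ltW.
have A1 : A < 1 by rewrite ltr_pdivrMr// mul1r.
have d0 : (0 < m.+1 - 2)%N by lia.
have h M : (k <= M)%N ->
    `|L (kernel_poly r k x * f) - sphere_integral r G| <= kernel_error (m.+1 - 2) A M * C.
  move=> /kernel_poly_stationary <-; rewrite /sphere_functional !sphere_integralE//.
  rewrite opprD addrACA mulrDr (le_trans (ler_normD _ _))// lerD//;
    by apply: hemisphere_integral_error => //; rewrite ?sqrrN expr1n.
apply/eqP; rewrite eq_sym -subr_eq0 -normr_le0.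
have cv : kernel_error (m.+1 - 2) A M * C @[M --> \oo] --> 0.
  by rewrite -(mul0r C); apply: cvgM; [exact: kernel_error_cvg0|exact: cvg_cst].
apply: (cvgr_to_ge cv); near=> M; apply: h; near: M; exact: nbhs_infty_ge.
Unshelve. all: by end_near. Qed.

Lemma kernel_poly_moment : exists p : mpoly m.+1 R, degree_at_most k p /\
  forall x, L (kernel_poly r k x * f) = poly_fun p x.
Proof.
have /choice[P hP] : forall j : 'I_k.+1, exists p : mpoly m.+1 R,
    (msize p <= j.+1)%N /\ forall x, L (zonal x j * f) = meval (x 0) p.
  by move=> j; exact: (moment_zonal_poly n3 L_linear).
exists (\sum_(j < k.+1) (kappa (m.+1 - 2) j / r ^+ (2 * j)) *: P j); split.
  apply: (leq_trans (msize_sum _ _ _)); apply/bigmax_leqP_seq => j _ _.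
  apply: (leq_trans (msizeZ_le _ _)); apply: (leq_trans (hP j).1).
  by rewrite ltn_ord.
move=> x; rewrite /kernel_poly mulr_suml (functional_sum L_linear) /poly_fun raddf_sum /=.
by apply: eq_bigr => j _; rewrite -scalerAl (functionalZ L_linear) mevalZ (hP j).2.
Qed.

Lemma fundamental_solutionE (x y : 'rV[R]_m.+1) :
  fundamental_solution (x - y) =
  (m.+1%:R * (2 - m.+1%:R) * unit_ball_volume m.+1)^-1 / r ^+ (m.+1 - 2) *
    newton_kernel r x y.
Proof.
rewrite /fundamental_solution /newton_kernel mulrA divfK ?expf_neq0 ?gt_eqF//.
congr (_ * _).
have -> : 2 - m.+1%:Z = - (m.+1 - 2)%N%:Z by lia.
by rewrite exprnN.
Qed.

End sphere_potential.

Unset Implicit Arguments.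
Set Strict Implicit.
Set Printing Implicit Defensive.

Theorem theorem1p8 (R : realType) (n k : nat) (r : R)
    (hn : (3 <= n)%N) (hr : 0 < r)
    (f : mpoly n R) (hf : degree_at_most k f) :
  poly_on_ball k r (fun x : 'rV[R]_n =>
    sphere_integral r (fun y : 'rV[R]_n =>
      fundamental_solution (x - y) * poly_fun f y)).
Proof.
case: n hn f hf => // m hn f hf.
have [p [pk pE]] := kernel_poly_moment hr hn k f.
pose c : R := (m.+1%:R * (2 - m.+1%:R) * unit_ball_volume m.+1)^-1 / r ^+ (m.+1 - 2).
exists (c *: p); split; first exact: (leq_trans (msizeZ_le _ _)).
move=> x xr; rewrite [RHS]mevalZ -[meval _ p]/(poly_fun p x) -pE.
rewrite -(newton_potentialE hr hn hf xr).
have half (e : R) : e ^+ 2 = 1 ->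
    hemisphere_integral r e
      (fun y => fundamental_solution (x - y) * poly_fun f y) =
    c * hemisphere_integral r e (fun y => newton_kernel r x y * poly_fun f y).
  move=> e2; rewrite /hemisphere_integral -RintegralZl//; last first.
    exact: (integrable_newton_kernel hr hn f xr e2).
  by apply: eq_Rintegral => u _; rewrite (fundamental_solutionE hr hn) !mulrA.
by rewrite !sphere_integralE// !half ?sqrrN ?expr1n// mulrDr.
Qed.
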